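(* Suppose that $n$ is a natural number and that the linear functional $T_n:U_{2n}(\infty)\to\mathbb{C}$ is pseudo-positive definite with respect to the orthonormal basis $Y_{k,l}$, $l=1,\dots,a_k$, $k\in\mathbb{N}_0$. Assume that the non-negative measures $\sigma_{k,l}$ with support in $[0,\infty)$, constructed from the component functionals $T_{n,k,l}$ by Gauss–Jacobi quadrature as described in the context, satisfy $$C_N:=\sum_{k=0}^{\infty}\sum_{l=1}^{a_k}\int_0^\infty r^{N}r^{-k}\,d\sigma_{k,l}(r)<\infty\qquad\text{for any }N\in\mathbb{N}_0 .$$ Then there exists a pseudo-positive, signed moment measure $\sigma$ on $\mathbb{R}^d$ such that $$T_n(f)=\int_{\mathbb{R}^d}f\,d\sigma\qquad\text{for all } f\in U_{2n-1}(\infty).$$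
   Context: $\mathbb{S}^{d-1}$ is the unit sphere of $\mathbb{R}^d$ with surface measure $d\theta$. $\mathcal{H}_k(\mathbb{R}^d)$ is the space of harmonic homogeneous complex polynomials of degree $k$, $a_k=\dim\mathcal{H}_k(\mathbb{R}^d)$, and $Y_{k,l}:\mathbb{R}^d\to\mathbb{R}$, $l=1,\dots,a_k$, is a fixed basis of $\mathcal{H}_k(\mathbb{R}^d)$, orthonormal for $\langle f,g\rangle=\int_{\mathbb{S}^{d-1}}f\overline{g}\,d\theta$. Every polynomial $f\in\mathbb{C}[x_1,\dots,x_d]$ has a representation $f(x)=\sum_{k=0}^{\deg f}\sum_{l=1}^{a_k}p_{k,l}(|x|^2)Y_{k,l}(x)$ with univariate polynomials $p_{k,l}$. $U_m(\infty)$ is the space of all polynomials $f$ for which $\deg p_{k,l}\le m$ for all $k,l$. $\mathcal{P}_{\le m}$ is the space of univariate complex polynomials of degree $\le m$; $p^*$ has the complex conjugate coefficients of $p$. For linear $T_n:U_{2n}(\infty)\to\mathbb{C}$ the component functionals are $T_{n,k,l}(p):=T_n\big(p(|x|^2)Y_{k,l}(x)\big)$, $p\in\mathcal{P}_{\le 2n}$. $T_n$ is pseudo-positive definite if for all $k,l$: $T_{n,k,l}(p^*p)\ge0$ for all $p\in\mathcal{P}_{\le n}$ and $T_{n,k,l}(t\,p^*(t)p(t))\ge0$ for all $p\in\mathcal{P}_{\le n-1}$. Construction of $\sigma_{k,l}$. Case 1: there is a nonzero $p\in\mathcal{P}_{\le n}$ with $T_{n,k,l}(p^*p)=0$. Let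 $m\le n$ be the minimal degree of such a polynomial, so that $T_{n,k,l}(p^*p)>0$ for all nonzero $p\in\mathcal{P}_{\le m-1}$. Gauss–Jacobi quadrature for the restriction of $T_{n,k,l}$ to $\mathcal{P}_{\le 2m}$ gives nodes $t_{1,k,l}<\dots<t_{m,k,l}$ and weights $\alpha_{1,k,l},\dots,\alpha_{m,k,l}>0$ such that $\sigma_{k,l}:=\sum_{i=1}^m\alpha_{i,k,l}\delta_{t_{i,k,l}}$ coincides with $T_{n,k,l}$ on $\mathcal{P}_{\le 2m-1}$; the construction asserts that $t_{1,k,l}>0$ (from the second positivity condition) and that $\sigma_{k,l}$ in fact coincides with $T_{n,k,l}$ on $\mathcal{P}_{\le 2n-1}$. Case 2: $T_{n,k,l}(p^*p)>0$ for all nonzero $p\in\mathcal{P}_{\le n}$. Then $\sigma_{k,l}$ is again the measure obtained by Gauss–Jacobi quadrature, with support in $[0,\infty)$. In both cases $T_{n,k,l}(p)=\int_0^\infty p(t)\,d\sigma_{k,l}(t)$ for all $p\in\mathcal{P}_{\le 2n-1}$, and the construction asserts $\int_0^\infty r^{-k}\,d\sigma_{k,l}(r)<\infty$. A signed measure is a real-valued $\sigma$-additive set function on the Borel sets; it is a moment measure if all polynomials are integrable with respect to its total variation. A signed measure $\mu$ on $\mathbb{R}^d$ is pseudo-positive if $\int_{\mathbb{R}^d}h(|x|)Y_{k,l}(x)\,d\mu(x)\ge0$ for every continuous compactly supported $h:[0,\infty)\to[0,\infty)$ and all $k\in\mathbb{N}_0$, $l=1,\dots,a_k$.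
   Formalization: In C_N the measures σ_{k,l}, which live in the variable t = |x|², are first carried to the radius r = √t, so the condition is ΣΣ∫ t^{(N-k)/2} dσ_{k,l}(t) < ∞; read literally with r = t the claim fails for d ≥ 2 (e.g. σ_{k,1} = 3^k δ_4). *)

(* Defs.v *)
From HB Require Import structures.
From mathcomp Require Import all_boot all_order all_algebra.
From mathcomp Require Import all_classical all_reals all_analysis.
From mathcomp Require Import measurable_realfun.
From mathcomp Require Import complex.
From mathcomp Require mpoly.
(* The notations of mpoly clash with those of MathComp-Analysis, so only its
   structures are imported and its names are qualified. *)
Import (canonicals, coercions) mpoly.
Import numFieldNormedType.Exports.
Import Order.TTheory GRing.Theory Num.Theory.

Set Implicit Arguments.
Unset Strict Implicit.
Unset Printing Implicit Defensive.

Local Open Scope classical_set_scope.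
Local Open Scope ring_scope.

(* R^d is [d.-tuple R]; its measurable structure is the product of the Borel
   sigma-algebras of R, that is, the Borel sigma-algebra of R^d. *)

Section image_measure.
Context d1 d2 (T1 : measurableType d1) (T2 : measurableType d2) (R : realType).
Variables (m : {measure set T1 -> \bar R}) (f : T1 -> T2).

Definition image_measure (mf : measurable_fun setT f) : set T2 -> \bar R :=
  pushforward m f.

Hypothesis mf : measurable_fun setT f.
Local Notation im := (image_measure mf).

Let mpreimage A : measurable A -> measurable (f @^-1` A).
Proof. by move=> mA; rewrite -[X in measurable X]setTI; exact: mf. Qed.

Let im0 : im set0 = 0%E.
Proof. by rewrite /im /pushforward preimage_set0 measure0. Qed.

Let im_ge0 A : (0 <= im A)%E.
Proof. by rewrite /im /pushforward measure_ge0. Qed.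

Let im_sigma_additive : semi_sigma_additive im.
Proof.
move=> F mF tF mUF; rewrite /image_measure /pushforward preimage_bigcup.
apply: measure_semi_sigma_additive.
- by move=> i; exact: mpreimage.
- apply/trivIsetP => /= i j _ _ ij; rewrite -preimage_setI.
  by move/trivIsetP : tF => /(_ _ _ _ _ ij) ->//; rewrite preimage_set0.
- by rewrite -preimage_bigcup; exact: mpreimage.
Qed.

HB.instance Definition _ := isMeasure.Build _ _ _ im
  im0 im_ge0 im_sigma_additive.

End image_measure.

Lemma measurable_sqrt (R : realType) : measurable_fun setT (@Num.sqrt R).
Proof. exact: (continuous_measurable_fun (@sqrt_continuous R)). Qed.

Section euclidean_space.
Variables (R : realType) (d : nat).
Implicit Type x : d.-tuple R.

Definition enorm x : R := Num.sqrt (\sum_(i < d) tnth x i ^+ 2).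

Definition sphere : set (d.-tuple R) := [set x | enorm x = 1].

Definition direction x : d.-tuple R := [tuple tnth x i / enorm x | i < d].

Definition punctured_ball : set (d.-tuple R) := [set x | 0 < enorm x <= 1].

Let measurable_enorm : measurable_fun setT enorm.
Proof.
apply: measurableT_comp; first exact: measurable_sqrt.
apply: measurable_sum => i.
by apply: measurable_funX; exact: measurable_tnth.
Qed.

Lemma measurable_direction : measurable_fun setT direction.
Proof.
apply/measurable_fun_tnthP => i.
rewrite (_ : _ \o _ = fun x => tnth x i * (enorm x `^ (-1))); last first.
  by apply/funext => x /=; rewrite tnth_mktuple powR_inv1 ?sqrtr_ge0.
apply: measurable_funM; first exact: measurable_tnth.
by apply: (measurableT_comp (measurable_powR _)); exact: measurable_enorm.
Qed.

Lemma measurable_punctured_ball : measurable punctured_ball.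
Proof.
rewrite (_ : punctured_ball = enorm @^-1` `]0, 1]); last first.
  by apply/seteqP; split => x /=; rewrite in_itv.
rewrite -[X in measurable X]setTI; exact: measurable_enorm.
Qed.

End euclidean_space.

Section lebesgue.
Variable R : realType.

Definition cons_tuple n (y : measurableTypeR R * n.-tuple R) : n.+1.-tuple R :=
  [tuple of y.1 :: y.2].

Lemma measurable_cons_tuple n : measurable_fun setT (@cons_tuple n).
Proof.
exact: (@measurable_cons _ _ _ R fst n snd measurable_fst measurable_snd).
Qed.

Section lebesgue_cons.
Variables (n : nat) (m : {sigma_finite_measure set (n.-tuple R) -> \bar R}).

Definition lebesgue_cons : set (n.+1.-tuple R) -> \bar R :=
  image_measure (@lebesgue_measure R \x m)%E (@measurable_cons_tuple n).

HB.instance Definition _ := Measure.on lebesgue_cons.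

Let lebesgue_cons_sigma_finite : sigma_finite setT lebesgue_cons.
Proof.
have [F [TF mF]] : exists F : (set (measurableTypeR R * n.-tuple R))^nat,
    \bigcup_i F i = setT /\ forall i, measurable (F i) /\
      ((@lebesgue_measure R \x m) (F i) < +oo)%E.
  have /sigma_finiteP[F [TF ndF Foo]] := sigma_finiteT (@lebesgue_measure R).
  have /sigma_finiteP[G [TG ndG Goo]] := sigma_finiteT m.
  exists (fun i => F i `*` G i); split => [|k].
    rewrite -setXTT TF TG predeqE => -[x y]; split.
      by move=> [i _ []/= ? ?]; split; exists i.
    move=> [/= [i _ Fnx] [k _ Gky]]; exists (maxn i k) => //; split.
    - by move: x Fnx; exact/subsetPset/ndF/leq_maxl.
    - by move: y Gky; exact/subsetPset/ndG/leq_maxr.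
  have [? ?] := Foo k; have [? ?] := Goo k.
  split; first exact: measurableX.
  by rewrite product_measure1E// lte_mul_pinfty// ge0_fin_numE.
pose u (x : n.+1.-tuple R) : measurableTypeR R * n.-tuple R :=
  (thead x, [tuple of behead x]).
have mu' : measurable_fun setT u.
  apply/measurable_fun_pairP; split; first exact: measurable_tnth.
  exact: measurable_behead.
have uK : u \o @cons_tuple n = id.
  apply/funext => -[y x] /=; rewrite /u /cons_tuple /=; congr (_, _).
  exact: val_inj.
exists (fun i => u @^-1` F i).
  by rewrite -preimage_bigcup TF preimage_setT.
move=> i; have [mFi Fioo] := mF i; split.
  by rewrite -[X in measurable X]setTI; exact: mu'.
by rewrite /lebesgue_cons /image_measure /pushforward -comp_preimage uK.
Qed.

HB.instance Definition _ := Measure_isSigmaFinite.Build _ _ _ lebesgue_cons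
  lebesgue_cons_sigma_finite.

End lebesgue_cons.

Fixpoint lebesgue n : {sigma_finite_measure set (n.-tuple R) -> \bar R} :=
  match n with
  | 0 => dirac [tuple]
  | n'.+1 => lebesgue_cons (lebesgue n')
  end.

End lebesgue.

(* The surface measure of the unit sphere S^{d-1} assigns to A the value
   d * lambda^d({r theta | 0 < r <= 1, theta \in A}); it is concentrated on
   [sphere]. *)
Definition surface_measure (R : realType) (d : nat) :
    {measure set (d.-tuple R) -> \bar R} :=
  mscale (d%:R : R)%:nng
    (image_measure (mrestr (lebesgue R d) (@measurable_punctured_ball R d))
                   (@measurable_direction R d)).

Definition cintegral d (T : measurableType d) (R : realType)
    (mu : {measure set T -> \bar R}) (D : set T) (f : T -> R[i]) : R[i] :=
  Complex (Rintegral mu D (fun x => complex.Re (f x)))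
          (Rintegral mu D (fun x => complex.Im (f x))).

(* Signed measures are MathComp-Analysis charges: finite valued and
   sigma-additive. *)
Section signed_measure.
Context d (T : measurableType d) (R : realType).
Variable nu : {charge set T -> \bar R}.

Lemma hahn_exists : exists PN : set T * set T,
  hahn_decomposition nu PN.1 PN.2.
Proof. by have [P [N nuPN]] := Hahn_decomposition nu; exists (P, N). Qed.

(* The Jordan decomposition does not depend on the Hahn decomposition chosen. *)
Definition hahn := svalP (cid hahn_exists).

Definition charge_total_variation : {measure set T -> \bar R} :=
  charge_variation hahn.

Definition charge_integral (f : T -> R) : R :=
  Rintegral (jordan_pos hahn) setT f - Rintegral (jordan_neg hahn) setT f.

Definition charge_cintegral (f : T -> R[i]) : R[i] :=
  Complex (charge_integral (fun x => complex.Re (f x)))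
          (charge_integral (fun x => complex.Im (f x))).

End signed_measure.

Notation cpoly R d := (mpoly.mpoly d R[i]).

Section polynomials.
Variables (R : realType) (d : nat).
Implicit Types (f : cpoly R d) (p : {poly R[i]}) (x : d.-tuple R).

Definition ceval f x : R[i] :=
  mpoly.meval (fun i => Complex (tnth x i) 0) f.

Definition normsq : cpoly R d :=
  \sum_(i < d) mpoly.mpolyX R[i] (mpoly.mnm1 i) ^+ 2.

(* p(|x|^2) *)
Definition radial p : cpoly R d := (map_poly (@mpoly.mpolyC d R[i]) p).[normsq].

Definition laplacian f : cpoly R d :=
  \sum_(i < d) mpoly.mderiv i (mpoly.mderiv i f).

Definition harmonic_homogeneous (k : nat) f : Prop :=
  f \is mpoly.ishomog1 k mpoly.mdeg /\ laplacian f = 0.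

(* In particular a k is the dimension of the space of harmonic homogeneous
   polynomials of degree k. *)
Definition orthonormal_harmonic_basis (a : nat -> nat)
    (Y : forall k, 'I_(a k) -> cpoly R d) : Prop :=
  [/\ forall k (l : 'I_(a k)), harmonic_homogeneous k (Y k l),
      forall k f, harmonic_homogeneous k f ->
        exists! c : {ffun 'I_(a k) -> R[i]}, f = \sum_(l < a k) c l *: Y k l,
      forall k (l : 'I_(a k)) x, complex.Im (ceval (Y k l) x) = 0
    & forall k (l l' : 'I_(a k)),
        cintegral (surface_measure R d) (@sphere R d)
          (fun x => ceval (Y k l) x * (ceval (Y k l') x)^*) = (l == l')%:R].

Section expansions.
Variables (a : nat -> nat) (Y : forall k, 'I_(a k) -> cpoly R d).

(* U_m(oo). The representation of f is unique and involves only indices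
   k <= deg f, so the cut-off K may be left free. *)
Definition U (m : nat) f : Prop :=
  exists (K : nat) (p : forall k, 'I_(a k) -> {poly R[i]}),
    (forall k (l : 'I_(a k)), (size (p k l) <= m.+1)%N) /\
    f = \sum_(k < K) \sum_(l < a k) radial (p k l) * Y l.

Definition linear_on (A : cpoly R d -> Prop) (T : cpoly R d -> R[i]) : Prop :=
  forall (c : R[i]) f g, A f -> A g -> T (c *: f + g) = c * T f + T g.

Definition component (T : cpoly R d -> R[i]) k (l : 'I_(a k)) p : R[i] :=
  T (radial p * Y l).

End expansions.
End polynomials.

Section univariate.
Variable R : realType.
Implicit Types (p : {poly R[i]}) (L : {poly R[i]} -> R[i]).

Definition conj_poly p : {poly R[i]} := map_poly (fun c : R[i] => c^*) p.

(* Order on complex numbers: 0 <= z means that z is real and nonnegative. *)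
Definition positive_functional (n : nat) L : Prop :=
  (forall p, (size p <= n.+1)%N -> 0 <= L (conj_poly p * p)) /\
  (forall p, (size p <= n.-1.+1)%N -> 0 <= L ('X * (conj_poly p * p))).

(* The number m of Gauss-Jacobi nodes for a functional on P_{<= 2n}: the
   minimal degree of a nonzero p with L(p^* p) = 0 if there is such a p of
   degree at most n, and n otherwise. *)
Definition quadrature_order (n : nat) L (m : nat) : Prop :=
  [/\ (m <= n)%N,
      exists p, size p = m.+1 /\ L (conj_poly p * p) = 0
    & forall p, p != 0 -> (size p <= m)%N -> L (conj_poly p * p) <> 0]
  \/
  (m = n /\
   forall p, p != 0 -> (size p <= n.+1)%N -> 0 < L (conj_poly p * p)).

(* m nodes, positive weights, exactness on P_{<= 2m-1}. *)
Definition gauss_jacobi (n : nat) L (sigma : {measure set R -> \bar R}) :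
    Prop :=
  exists (m : nat) (t alpha : 'I_m -> R),
    [/\ quadrature_order n L m,
        (forall i j : 'I_m, (i < j)%N -> t i < t j),
        (forall i, 0 < alpha i),
        (forall A, measurable A ->
           sigma A = (\sum_(i < m) (alpha i)%:E * \d_(t i) A)%E)
      & forall p, (size p <= 2 * m)%N ->
          L p = cintegral sigma setT (fun t => p.[Complex t 0])].

(* The quadrature measures live on the axis of the variable t = |x|^2, whereas
   the weight r^N r^{-k} refers to the radius r = |x|: this is the image of
   sigma under t |-> sqrt t. *)
Definition radius_measure (sigma : {measure set R -> \bar R}) :
    {measure set R -> \bar R} :=
  image_measure sigma (@measurable_sqrt R).

(* The inverse is the one of extended reals, so r^{-k} = +oo at r = 0 if
   0 < k. *)
Definition C_ (a : nat -> nat)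
    (sigma : forall k, 'I_(a k) -> {measure set R -> \bar R}) (N : nat) :
    \bar R :=
  (\sum_(0 <= k <oo) \sum_(l < a k)
    \int[radius_measure (sigma k l)]_(r in `[0%R, +oo[)
      ((r ^+ N)%:E * ((r ^+ k)%:E)^-1))%E.

End univariate.

Section conclusion.
Variables (R : realType) (d : nat) (a : nat -> nat).
Variable Y : forall k, 'I_(a k) -> cpoly R d.

Definition pseudo_positive_definite (n : nat) (T : cpoly R d -> R[i]) : Prop :=
  forall k (l : 'I_(a k)), positive_functional n (component Y T l).

Implicit Type mu : {charge set (d.-tuple R) -> \bar R}.

Definition moment_measure mu : Prop :=
  forall f : cpoly R d,
    (charge_total_variation mu).-integrable setT
      (fun x => (complex.Re (ceval f x))%:E) /\
    (charge_total_variation mu).-integrable setT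
      (fun x => (complex.Im (ceval f x))%:E).

(* The values of Y k l are real, so that Re does not lose anything. *)
Definition pseudo_positive mu : Prop :=
  forall h : R -> R,
    {within `[0, +oo[, continuous h} ->
    (forall r, 0 <= r -> 0 <= h r) ->
    (exists M : R, forall r, M < r -> h r = 0) ->
    forall k (l : 'I_(a k)),
      0 <= charge_integral mu
             (fun x => h (enorm x) * complex.Re (ceval (Y l) x)).

End conclusion.

(* Main.v *)
From HB Require Import structures.
Require Import Defs.
From mathcomp Require Import all_boot all_order all_algebra.
From mathcomp Require Import all_classical all_reals all_analysis.
From mathcomp Require Import measurable_realfun.
From mathcomp Require Import complex ring lra zify.
From mathcomp Require mpoly.
Import (canonicals, coercions) mpoly.
Import Order.TTheory GRing.Theory Num.Theory.
Import numFieldNormedType.Exports.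
Set Implicit Arguments.
Unset Strict Implicit.
Unset Printing Implicit Defensive.
Local Open Scope classical_set_scope.
Local Open Scope ring_scope.

(** The charge is $\sum_{k,l} r^{-k}\,d\sigma_{k,l}(r)\,Y_{k,l}(\theta)\,d\theta$,
    where $\sigma_{k,l}$ is carried to the radius $r = \sqrt{t}$.  Since
    $\int_S |Y_{k,l}| \le (|S| + 1)/2$, the numbers $C_N$ bound the total
    variation and all the moments, and $C_0 < \infty$ forbids an atom at the
    origin when $k > 0$.  Integrating $h(|x|) Y_{k,l}(x)$ against it leaves
    $\int h(r)\,d\sigma_{k,l}$, provided that the $Y_{k,l}$ are orthogonal also
    across different degrees.

    For this last fact, let $G(f) = \int f(x) e^{-|x|^2} dx$.  Integration by
    parts gives $2 G(x_i f) = G(\partial_i f)$, so for $P$, $Q$ harmonic and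
    homogeneous Euler's identity yields
    $2 (\deg Q) G(PQ) = \sum_i G(\partial_i P \partial_i Q) = 2 (\deg P) G(PQ)$.
    Polar coordinates, in the form that the sectors
    $\{x : x/|x| \in A, 0 < |x| \le r\}$ have volume proportional to $r^d$,
    turn $G(PQ) = 0$ into orthogonality on the sphere. *)

(** * Gauss-Jacobi quadrature *)

(** Integrals against a charge are defined through its Jordan decomposition, which is not explicit
    for the charge built here. It is obtained instead as a difference mu1 - mu2 of finite measures,
    in which $Y_{k,l}$ is replaced by its positive and by its negative part; comparing this
    difference with the Jordan decomposition is a separate step. The identity between the resulting
    series is stated additively, with nonnegative terms, so that no signed series has to be summed.

    The quadrature is exact only up to degree $2m-1$, and $m$ may be smaller than $n$. That it
    reaches degree $2n-1$, and that the nodes are nonnegative, has to be derived from the two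
    positivity conditions: a null vector of the form $L(p^* q)$ lies in its kernel, and the
    condition with the factor $t$ moves this kernel up in degree.

    The weight $e^{-|x|^2}$ is chosen because it is both a product, which reduces integration by
    parts to one-dimensional moments, and radial, which allows polar coordinates. *)

(** The degenerate case of Cauchy-Schwarz: the expression is the value at p + c r of a positive form
    that vanishes at p. Hermitian symmetry is not assumed; it is read off from the reality of the
    expression at c = 1 and c = 'i. The denominator D + 1 appears because D may be 0. *)
Lemma psd_cross_eq0 (C : numClosedFieldType) (A B D : C) : 0 <= D ->
  (forall c : C, 0 <= c * A + c^* * B + c * c^* * D) -> A = 0.
Proof.
move=> D0 h.
have rD : D^* = D by apply/CrealP; exact: ger0_real.
have h1 : (A + B)^* = A + B.
  apply/CrealP; have /ger0_real := h 1; rewrite conjC1 !mul1r.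
  by rewrite rpredDr // ger0_real.
have h2 : ('i * A - 'i * B)^* = 'i * A - 'i * B.
  apply/CrealP; have /ger0_real := h 'i; rewrite conjCi.
  rewrite mulNr mulrN -expr2 sqrCi opprK mul1r.
  by rewrite rpredDr // ger0_real.
have AB : B = A^*.
  move: h1 h2; rewrite rmorphD rmorphB 2!rmorphM /= conjCi => h1 h2.
  have h2' : B^* - A^* = A - B.
    apply: (mulfI (neq0Ci C)); transitivity ('i * A - 'i * B); last by ring.
    by rewrite -[RHS]h2; ring.
  apply: (mulfI (_ : 2%:R != 0)); first by rewrite pnatr_eq0.
  transitivity ((A + B) - (A - B)); first ring.
  rewrite -h1 -h2'; ring.
pose e := (D + 1)^-1.
have e0 : 0 < e by rewrite invr_gt0 ltr_wpDl.
have re : e^* = e by apply/CrealP; apply: ger0_real; exact: ltW.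
have eD : e * (D + 1) = 1 by rewrite mulVf // gt_eqF // ltr_wpDl.
(* Once B = A^*, the choice c = - A^* / (D + 1) gives a negative multiple of
   |A|^2. *)
have := h (- e * A^*).
rewrite AB rmorphM rmorphN /= re conjCK => h3.
have {}h3 : 0 <= - (`|A| ^+ 2 * (e * (1 + e))).
  rewrite normCK; apply: (le_trans h3); rewrite le_eqVlt; apply/orP; left; apply/eqP.
  transitivity (- (A * A^*) * e * (2%:R - (e * (D + 1) - e))); first ring.
  rewrite eD; ring.
rewrite oppr_ge0 in h3.
have : `|A| ^+ 2 <= 0 by move: h3; rewrite pmulr_lle0 // mulr_gt0 // addr_gt0.
move=> A0; apply/eqP; rewrite -normr_eq0 -sqrf_eq0 eq_le A0 exprn_ge0 //.
Qed.

Section quadrature.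
Variable R : realType.
Implicit Types (p q r : {poly R[i]}).

Lemma conj_polyM p q : conj_poly (p * q) = conj_poly p * conj_poly q.
Proof. exact: rmorphM. Qed.

Lemma conj_polyD p q : conj_poly (p + q) = conj_poly p + conj_poly q.
Proof. exact: rmorphD. Qed.

Lemma conj_polyZ c p : conj_poly (c *: p) = c^* *: conj_poly p.
Proof. exact: (map_polyZ (@Num.conj R[i])). Qed.

Lemma conj_polyXn i : conj_poly 'X^i = 'X^i :> {poly R[i]}.
Proof. exact: map_polyXn. Qed.

Lemma size_conj_poly p : size (conj_poly p) = size p.
Proof. exact: size_map_poly. Qed.

Lemma conjC_real (x : R) : (x%:C%C)^* = x%:C%C.
Proof. by rewrite /Num.conj /= oppr0. Qed.

Lemma conj_poly_horner p (t : R) :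
  (conj_poly p).[t%:C%C] = (p.[t%:C%C])^*.
Proof.
rewrite -[t%:C%C in LHS]conjC_real.
exact: horner_map.
Qed.

(** [psd_cross_eq0] for the form L(u p^* q). The factor u is 1 for the first positivity condition
    and 'X for the second. *)
Lemma positive_kernel (L : {scalar {poly R[i]}}) (u : {poly R[i]}) (N : nat) p r :
  (forall q, (size q <= N)%N -> 0 <= L (u * (conj_poly q * q))) ->
  (size p <= N)%N -> (size r <= N)%N -> L (u * (conj_poly p * p)) = 0 ->
  L (u * (conj_poly p * r)) = 0.
Proof.
move=> Lpos sp sr Lp0.
apply: (@psd_cross_eq0 _ _ (L (u * (conj_poly r * p))) (L (u * (conj_poly r * r)))).
  exact: Lpos.
move=> c; have := Lpos (p + c *: r).
rewrite (leq_trans (size_polyD _ _)); last first.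
  by rewrite geq_max sp (leq_trans (size_scale_leq _ _)).
move=> /(_ isT); rewrite conj_polyD conj_polyZ.
rewrite mulrDl !mulrDr !linearD /= Lp0 add0r.
rewrite -!scalerAl -!scalerAr !linearZ /= -?scalerAr !linearZ /= ?linearZ /=.
by rewrite addrA.
Qed.

Variables (n m : nat) (L : {scalar {poly R[i]}}) (t alpha : 'I_m -> R).
Hypothesis tinj : injective t.
Hypothesis alpha_gt0 : forall i, 0 < alpha i.
Hypothesis mn : (m <= n)%N.
Hypothesis Lpos : positive_functional n L.
Hypothesis n_gt0 : (0 < n)%N.
Hypothesis exact2m : forall p, (size p <= 2 * m)%N ->
  L p = \sum_(i < m) (alpha i)%:C%C * p.[(t i)%:C%C].

Let positive_kernel1 p r : (size p <= n.+1)%N -> (size r <= n.+1)%N ->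
  L (conj_poly p * p) = 0 -> L (conj_poly p * r) = 0.
Proof.
move=> sp sr; rewrite -[conj_poly p * p]mul1r -[conj_poly p * r]mul1r.
by apply: (@positive_kernel L 1 n.+1) => // q sq; rewrite mul1r; exact: Lpos.1.
Qed.

Let node (A : pred 'I_m) : {poly R[i]} :=
  \prod_(i <- enum A) ('X - ((t i)%:C%C)%:P).

Let size_node A : size (node A) = #|A|.+1.
Proof. by rewrite size_prod_XsubC cardE. Qed.

Let node_horner A z : (node A).[z] = \prod_(i in A) (z - (t i)%:C%C).
Proof.
rewrite /node horner_prod big_enum /=.
by apply: eq_bigr => i _; rewrite hornerXsubC.
Qed.

Let node_eq0 (A : pred 'I_m) j : A j -> (node A).[(t j)%:C%C] = 0.
Proof. by move=> Aj; rewrite node_horner (bigD1 j) //= subrr mul0r. Qed.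

Let node_neq0 (A : pred 'I_m) j : ~~ A j -> (node A).[(t j)%:C%C] != 0.
Proof.
move=> Aj; rewrite node_horner prodf_seq_neq0; apply/allP => i _.
apply/implyP => Ai; rewrite subr_eq0; apply: contraNneq Aj => /complexI /tinj ->.
exact: Ai.
Qed.

(** Test the second positivity condition on the polynomial p of degree m - 1 that vanishes at all
    other nodes: t p^* p has degree 2m - 1, still in the exact range, and only alpha_i t_i
    |p(t_i)|^2 survives. *)
Lemma nodes_ge0 i : 0 <= t i.
Proof.
pose p := node (predC1 i).
have sp : size p = m.
  by rewrite size_node cardC1 card_ord prednK // (leq_ltn_trans _ (ltn_ord i)).
have := Lpos.2 p; rewrite sp prednK // mn => /(_ isT).
rewrite exact2m; last first.
  rewrite mulrC size_mulX; last first.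
    rewrite mulf_neq0 // -size_poly_gt0 ?size_conj_poly sp; exact: (leq_ltn_trans _ (ltn_ord i)).
  have p0 : p != 0 by rewrite -size_poly_gt0 sp (leq_ltn_trans _ (ltn_ord i)).
  rewrite size_mul // -?size_poly_gt0 ?size_conj_poly ?sp; last first.
    exact: (leq_ltn_trans _ (ltn_ord i)).
  by have := ltn_ord i; lia.
rewrite (bigD1 i) //= big1 ?addr0; last first.
  by move=> j ji; rewrite !hornerM /p node_eq0 // !mulr0.
rewrite !hornerM hornerX conj_poly_horner -(normCKC p.[_]).
rewrite mulrA pmulr_lge0; last first.
  by rewrite exprn_gt0 // normr_gt0 node_neq0 //= negbK.
by rewrite -rmorphM /= ler0c pmulr_rge0.
Qed.

Let w := node predT.

Let conj_w : conj_poly w = w.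
Proof.
rewrite /w /node /conj_poly rmorph_prod; apply: eq_bigr => i _.
rewrite rmorphB /= map_polyX map_polyC; congr (_ - _%:P).
exact: conjC_real.
Qed.

(** The null vector q turns out to be proportional to the node polynomial [w], and L annihilates [w]
    times every polynomial of degree below 2n - m. Dividing p by [w] leaves a remainder that has the
    same values at the nodes and a degree at which the quadrature is exact. *)
Lemma exact_extend q : size q = m.+1 -> L (conj_poly q * q) = 0 ->
  forall p, (size p <= 2 * n)%N ->
  L p = \sum_(i < m) (alpha i)%:C%C * p.[(t i)%:C%C].
Proof.
move=> sq Lq.
have q0 : q != 0 by rewrite -size_poly_gt0 sq.
have sw : size w = m.+1 by rewrite size_node card_ord.
have w0 : w != 0 by rewrite -size_poly_gt0 sw.
(* L kills q^* p for the p that isolates node i, because q is in the kernel. The degree of q^* p is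
   2m - 1, so the quadrature computes this number, and its only surviving term contains the value of
   q^* at t_i. *)
have qt i : (conj_poly q).[(t i)%:C%C] = 0.
  pose p := node (predC1 i).
  have sp : size p = m.
    by rewrite size_node cardC1 card_ord prednK // (leq_ltn_trans _ (ltn_ord i)).
  have := @positive_kernel1 q p.
  rewrite sq sp => /(_ mn (leqW mn) Lq).
  rewrite exact2m; last first.
    have p0 : p != 0 by rewrite -size_poly_gt0 sp (leq_ltn_trans _ (ltn_ord i)).
    rewrite size_mul // -?size_poly_gt0 ?size_conj_poly ?sp ?sq //; lia.
  rewrite (bigD1 i) //= big1 ?addr0; last first.
    by move=> j ji; rewrite !hornerM /p node_eq0 // !mulr0.
  move/eqP; rewrite hornerM !mulf_eq0 (negbTE (node_neq0 _)) ?negbK //= orbF.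
  rewrite (_ : (alpha i)%:C%C == 0 = false) //=; first by move/eqP.
  by rewrite eq_complex /= eqxx andbT gt_eqF.
have qw : w %= q.
  rewrite -dvdp_size_eqp ?sw ?sq //.
  rewrite /w /node -(big_map (fun i => (t i)%:C%C) xpredT (fun z => 'X - z%:P)).
  apply: uniq_roots_dvdp; last first.
    rewrite uniq_rootsE map_inj_uniq ?enum_uniq //.
    by move=> i j /complexI /tinj.
  apply/allP => z /mapP [i _ ->]; rewrite rootE.
  by have := qt i; rewrite conj_poly_horner => /eqP; rewrite conjC_eq0.
have Lw : L (conj_poly w * w) = 0.
  have [c -> ] : exists c, w = c *: q.
    have /eqpP [[a b] /= /andP [a0 b0] e] := qw.
    by exists (a^-1 * b); rewrite -scalerA -e scalerA mulVf // scale1r.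
  by rewrite conj_polyZ -scalerAl -scalerAr !linearZ /= Lq !mulr0.
have sX j : size ('X^j * w) = (j + m).+1.
  by rewrite size_monicM ?monicXn // size_polyXn sw addSn /= addnS.
have cX j : conj_poly ('X^j * w) = 'X^j * w.
  by rewrite conj_polyM conj_polyXn conj_w.
(* w spans the kernel of L(p^* q) on degree <= m, and the positivity of
   L(t p^* p) propagates the kernel from 'X^j w to 'X^(j+1) w. *)
have step j (r : {poly R[i]}) : (j + m < n)%N ->
    L (('X^j * w : {poly R[i]}) * ('X^j * w)) = 0 ->
    (size r <= n)%N -> L ('X^(j.+1) * w * r) = 0.
  move=> jn Lj sr.
  have := @positive_kernel L 'X n ('X^j * w) r.
  rewrite cX sX exprS -!mulrA => H; apply: H => //.
    by move=> s ss; apply: Lpos.2; rewrite prednK.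
  rewrite !mulrA in Lj *; rewrite -exprS.
  rewrite [X in L X](_ : _ = conj_poly ('X^j * w) * ('X^(j.+1) * w)); last first.
    by rewrite cX exprS; ring.
  apply: positive_kernel1 => //.
  - by rewrite sX ltnS ltnW.
  - by rewrite sX addSn ltnS.
  - by rewrite cX mulrA.
have ker j : (j + m < n)%N -> L (('X^j * w : {poly R[i]}) * ('X^j * w)) = 0.
  elim: j => [_|j IH jn]; first by rewrite mul1r -{1}conj_w.
  by apply: step => //; [lia|apply: IH; lia|rewrite sX].
(* For i <= n this is the kernel relation of [w] against 'X^i. For larger i, write 'X^i as 'X^(j+1)
   times 'X^(n-1) with j = i - n; then i < 2n - m gives j + m < n, as [step] requires. *)
have Lwi i : (i < 2 * n - m)%N -> L ('X^i * w) = 0.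
  move=> ilt; have [iln|nli] := leqP i n.
    rewrite mulrC -conj_w; apply: positive_kernel1 => //.
    - by rewrite sw ltnS.
    - by rewrite size_polyXn.
  rewrite (_ : i = ((i - n).+1 + n.-1)%N); last by lia.
  rewrite exprD mulrAC; apply: step.
  - by lia.
  - by apply: ker; lia.
  - by rewrite size_polyXn prednK.
move=> p sp; rewrite (divp_eq p w) linearD /= [X in X + _](_ : _ = 0) ?add0r.
  rewrite exact2m; last first.
    apply: (@leq_trans m); last by lia.
    by rewrite -ltnS -sw ltn_modpN0.
  apply: eq_bigr => i _; rewrite hornerD hornerM.
  by rewrite /w node_eq0 // mulr0 add0r.
rewrite -[p %/ w]coefK poly_def mulr_suml linear_sum big1 //= => i _.
rewrite -scalerAl linearZ /= Lwi ?mulr0 //.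
have si : (size (p %/ w)%R <= 2 * n - m)%N by rewrite size_divp // sw leq_sub2r.
exact: leq_trans (ltn_ord i) si.
Qed.

End quadrature.

(** * Measures and charges *)

Section measures.
Context d (T : measurableType d) (R : realType).
Local Open Scope ereal_scope.

Import HBNNSimple.

(** Serves for a radial weight on Lebesgue measure and for a density on the sphere. On indicators
    the formula is the definition of [n]; simple functions and monotone convergence do the rest. *)
Lemma exists_density (mu : {measure set T -> \bar R}) (w : T -> R) :
  measurable_fun setT w -> (forall x, (0 <= w x)%R) ->
  exists nu : {measure set T -> \bar R}, forall f : T -> \bar R,
    measurable_fun setT f -> (forall x, 0 <= f x) ->
    \int[nu]_x f x = \int[mu]_x (f x * (w x)%:E).
Proof.
move=> /measurable_EFinP mg w0.
pose g x := (w x)%:E.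
have g0 x : 0 <= g x by rewrite lee_fin.
pose n A := \int[mu]_(x in A) g x.
have n0 : n set0 = 0 by rewrite /n integral_set0.
have n_ge0 A : 0 <= n A by apply: integral_ge0 => x _.
have ns : semi_sigma_additive n by exact: semi_sigma_additive_nng_induced.
pose nu : {measure set T -> \bar R} := HB.pack n
  (isMeasure.Build _ _ _ n n0 n_ge0 ns).
exists nu => f mf f0; pose h := nnsfun_approx measurableT mf.
have hE x : f x = limn (fun k => (h k x)%:E).
  by apply/esym/cvg_lim => //; exact: cvg_nnsfun_approx.
have h_nd x a b : (a <= b)%N -> (h a x)%:E <= (h b x)%:E.
  by move=> ab; rewrite lee_fin; exact/lefP/nd_nnsfun_approx.
transitivity (limn (fun k => \int[nu]_x (h k x)%:E)).
  rewrite -monotone_convergence //.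
  - by apply: eq_integral => x _; rewrite hE.
  - by move=> k; exact/measurable_EFinP/measurable_funP.
  - by move=> k x _; rewrite lee_fin.
  - by move=> x _ a b; exact: h_nd.
transitivity (limn (fun k => \int[mu]_x ((h k x)%:E * g x))); last first.
  rewrite -monotone_convergence //.
  - apply: eq_integral => x _; apply/cvg_lim => //.
    apply: cvgeZr => //; exact: cvg_nnsfun_approx.
  - move=> k; apply: emeasurable_funM => //; exact/measurable_EFinP/measurable_funP.
  - by move=> k x _; rewrite mule_ge0 // lee_fin.
  - by move=> x _ a b ab; rewrite lee_wpmul2r //; exact: h_nd.
congr (limn _); apply/funext => k.
under eq_integral do rewrite fimfunE -fsumEFin//.
rewrite ge0_integral_fsum//; last 2 first.
  - by move=> r; apply/measurable_EFinP; exact: measurable_funM.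
  - by move=> r x _; rewrite EFinM nnfun_muleindic_ge0.
under [RHS]eq_integral => x _.
  rewrite fimfunE -fsumEFin// ge0_mule_fsuml; last first.
    by move=> r; rewrite EFinM nnfun_muleindic_ge0.
  over.
rewrite ge0_integral_fsum//; last 2 first.
  - move=> r; apply: emeasurable_funM => //; apply/measurable_EFinP.
    exact: measurable_funM.
  - by move=> r x _; rewrite mule_ge0 // EFinM nnfun_muleindic_ge0.
apply: eq_fsbigr => r; rewrite inE => -[x0 _ rE].
have r0 : (0 <= r)%R by rewrite -rE.
rewrite integralZl_indic_nnsfun // integral_indic // setIT.
under [RHS]eq_integral do rewrite EFinM -muleA.
rewrite ge0_integralZl //.
- congr (_ * _); rewrite /= /n integral_mkcond; apply: eq_integral => x _.
  by rewrite epatch_indic muleC.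
- apply: emeasurable_funM => //; exact/measurable_EFinP.
- by move=> x _; rewrite mule_ge0 // lee_fin.
Qed.

Lemma exists_measure_sum (I : Type) (s : seq I)
    (mu : I -> {measure set T -> \bar R}) :
  exists nu : {measure set T -> \bar R},
    (forall A, nu A = \sum_(i <- s) mu i A) /\
    forall f : T -> \bar R, measurable_fun setT f -> (forall x, 0 <= f x) ->
      \int[nu]_x f x = \sum_(i <- s) \int[mu i]_x f x.
Proof.
elim: s => [|i s [nu [nuE nuI]]].
  exists mzero; split => [A|f mf f0]; first by rewrite big_nil.
  by rewrite big_nil integral_measure_zero.
exists (measure_add (mu i) nu); split => [A|f mf f0].
  by rewrite big_cons -nuE; exact: (@measure_addE _ _ _ (mu i) nu).
by rewrite big_cons ge0_integral_measure_add // nuI.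
Qed.

Lemma ge0_integral_atomic (I : finType) (mu : {measure set T -> \bar R})
    (t : I -> T) (c : I -> R) : (forall i, (0 <= c i)%R) ->
  (forall A, measurable A -> mu A = \sum_i (c i)%:E * \d_(t i) A) ->
  forall f : T -> \bar R, measurable_fun setT f -> (forall x, 0 <= f x) ->
    \int[mu]_x f x = \sum_i (c i)%:E * f (t i).
Proof.
move=> c0 muE f mf f0.
pose m i : {measure set T -> \bar R} := mscale (NngNum (c0 i)) (dirac (t i)).
have [nu [nuE nuI]] := exists_measure_sum (index_enum I) m.
rewrite (eq_measure_integral nu); last first.
  by move=> A mA _; rewrite muE // nuE.
rewrite nuI //; apply: eq_bigr => i _.
by rewrite ge0_integral_mscale //= integral_dirac // diracT mul1e.
Qed.

Lemma Rintegral_atomic (I : finType) (mu : {measure set T -> \bar R})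
    (t : I -> T) (c : I -> R) : (forall i, (0 <= c i)%R) ->
  (forall A, measurable A -> mu A = \sum_i (c i)%:E * \d_(t i) A) ->
  forall f : T -> R, measurable_fun setT f ->
    Rintegral mu setT f = (\sum_i c i * f (t i))%R.
Proof.
move=> c0 muE f mf; rewrite /Rintegral integralE.
rewrite !(ge0_integral_atomic c0 muE) //; last 2 first.
- exact/measurable_funeneg/measurable_EFinP.
- exact/measurable_funepos/measurable_EFinP.
under eq_bigr do rewrite funeposE -EFin_max -EFinM.
under [X in _ - X]eq_bigr do rewrite funenegE -EFinN -EFin_max -EFinM.
rewrite !sumEFin -EFinB /= -sumrB; apply: eq_bigr => i _.
rewrite -mulrBr; congr (_ * _)%R.
exact: (congr1 (@^~ (t i)) (funrposBneg f)).
Qed.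

End measures.

Section charge_diff.
Context d (T : measurableType d) (R : realType).
Local Open Scope ereal_scope.

Lemma integrable_le_measure (mu nu : {measure set T -> \bar R}) (f : T -> \bar R) :
  (forall A, measurable A -> nu A <= mu A) ->
  mu.-integrable setT f -> nu.-integrable setT f.
Proof.
move=> le /integrableP [mf foo]; apply/integrableP; split => //.
apply: le_lt_trans foo; apply: ge0_le_measure_integral => //.
exact: measurableT_comp.
Qed.

Lemma integrable_measure_add (mu nu : {measure set T -> \bar R}) (f : T -> \bar R) :
  mu.-integrable setT f -> nu.-integrable setT f ->
  (measure_add mu nu).-integrable setT f.
Proof.
move=> /integrableP [mf foo] /integrableP [_ goo]; apply/integrableP; split => //.
rewrite ge0_integral_measure_add //; first exact: lte_add_pinfty.
exact: measurableT_comp.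
Qed.

Lemma Rintegral_measure_add (mu nu : {measure set T -> \bar R}) (f : T -> R) :
  mu.-integrable setT (EFin \o f) -> nu.-integrable setT (EFin \o f) ->
  Rintegral (measure_add mu nu : {measure set T -> \bar R}) setT f =
  (Rintegral mu setT f + Rintegral nu setT f)%R.
Proof.
move=> fmu fnu; have mf := measurable_int _ fmu.
rewrite /Rintegral integralE [in RHS]integralE [X in (_ + fine X)%R]integralE.
rewrite !ge0_integral_measure_add //; last 2 first.
- exact: measurable_funeneg.
- exact: measurable_funepos.
have fin (m : {measure set T -> \bar R}) : m.-integrable setT (EFin \o f) ->
    \int[m]_x (EFin \o f)^\+ x \is a fin_num /\
    \int[m]_x (EFin \o f)^\- x \is a fin_num.
  by move=> fm; split; apply: integrable_fin_num => //;
    [exact: integrable_funepos|exact: integrable_funeneg].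
have [p1 n1] := fin _ fmu; have [p2 n2] := fin _ fnu.
rewrite -(fineK p1) -(fineK p2) -(fineK n1) -(fineK n2) /= opprD addrACA //.
Qed.

(** The Jordan parts of mu1 - mu2 are dominated by mu1 and mu2, because each is the charge
    restricted to one Hahn set, up to sign. Integrability is thus inherited, and the integral does
    not see which representation as a difference is used. *)
Lemma exists_charge_diff (mu1 mu2 : {measure set T -> \bar R}) :
  mu1 setT < +oo -> mu2 setT < +oo ->
  exists nu : {charge set T -> \bar R}, forall f : T -> R,
    mu1.-integrable setT (EFin \o f) -> mu2.-integrable setT (EFin \o f) ->
    (charge_total_variation nu).-integrable setT (EFin \o f) /\
    charge_integral nu f = (Rintegral mu1 setT f - Rintegral mu2 setT f)%R.
Proof.
move=> fin1 fin2.
have finT (mu : {measure set T -> \bar R}) : mu setT < +oo -> fin_num_fun mu.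
  move=> muoo A mA; rewrite ge0_fin_numE //; apply: le_lt_trans muoo.
  by apply: le_measure; rewrite ?inE.
have exc (mu : {measure set T -> \bar R}) : mu setT < +oo ->
    exists c : {charge set T -> \bar R}, forall A, c A = mu A.
  move=> muoo; pose n A := mu A.
  have n0 : n set0 = 0 by exact: measure0.
  have nfin A : measurable A -> n A \is a fin_num by exact: finT.
  have ns : semi_sigma_additive n by exact: measure_semi_sigma_additive.
  pose c : {charge set T -> \bar R} := HB.pack n (isCharge.Build _ _ _ n n0 nfin ns).
  by exists c.
have [c1 c1E] := exc _ fin1; have [c2 c2E] := exc _ fin2.
pose nu : {charge set T -> \bar R} := cadd c1 (copp c2).
have nuE A : nu A = mu1 A - mu2 A by rewrite -c1E -c2E.
exists nu => f f1 f2.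
have [[mP _] [mN _] PN PN0] := svalP (cid (hahn_exists nu)).
set jp := jordan_pos (hahn nu); set jn := jordan_neg (hahn nu).
have fin_sub A B (mu : {measure set T -> \bar R}) : mu setT < +oo ->
    measurable A -> measurable B -> mu (A `&` B) <= mu A.
  by move=> _ mA mB; apply: le_measure; rewrite ?inE //; exact: measurableI.
have jp_le A : measurable A -> jp A <= mu1 A.
  move=> mA; rewrite /jp jordan_posE cjordan_posE /crestr0 mem_set //= /crestr nuE.
  apply: (@le_trans _ _ (mu1 (A `&` (sval (cid (hahn_exists nu))).1))).
    by rewrite leeBlDr ?finT ?leeDl //; exact: measurableI.
  exact: fin_sub.
have jn_le A : measurable A -> jn A <= mu2 A.
  move=> mA; rewrite /jn jordan_negE cjordan_negE /crestr0 mem_set //= /crestr nuE.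
  rewrite fin_num_oppeB; last by rewrite finT //; exact: measurableI.
  apply: (@le_trans _ _ (mu2 (A `&` (sval (cid (hahn_exists nu))).2))).
    rewrite addeC leeBlDr ?finT ?leeDl //; exact: measurableI.
  exact: fin_sub.
have fp := integrable_le_measure jp_le f1.
have fn := integrable_le_measure jn_le f2.
split.
  apply: integrable_le_measure (integrable_measure_add fp fn) => A mA.
  have -> : charge_total_variation nu A = jp A + jn A by [].
  by rewrite -measure_addE.
rewrite /charge_integral -/jp -/jn.
(* Moving the subtracted terms across leaves a comparison of the measures mu1 + jn and jp + mu2,
   which agree on every measurable set since jp - jn = mu1 - mu2. *)
apply/eqP; rewrite subr_eq addrAC eq_sym subr_eq -!Rintegral_measure_add //.
rewrite /Rintegral; apply/eqP; congr fine.
apply: eq_measure_integral => A mA _.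
transitivity (mu1 A + jn A); first exact: measure_addE.
transitivity (jp A + mu2 A); last exact/esym/measure_addE.
have jpA : jp A \is a fin_num by rewrite fin_num_measure.
have jnA : jn A \is a fin_num by rewrite fin_num_measure.
have := jordan_decomp (svalP (cid (hahn_exists nu))) mA.
rewrite /cadd /= cscaleN1 -/jp -/jn nuE.
rewrite -(fineK jpA) -(fineK jnA) -(fineK (finT _ fin1 _ mA)) -(fineK (finT _ fin2 _ mA)).
rewrite -[(\- _) A]/(- jn A) -[in - jn A](fineK jnA) -!EFinB -!EFinD => -[e].
by congr EFin; move: e; lra.
Qed.

End charge_diff.

(** * Orthogonality of harmonic polynomials for the Gaussian weight *)

Section harmonic_orthogonality.
Variables (R : realType) (d : nat).
Implicit Types (P Q f : cpoly R d).

Local Notation Xvar i := (mpoly.mpolyX R[i] (mpoly.mnm1 i)).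

Lemma euler_identity k Q : Q \is mpoly.ishomog1 k mpoly.mdeg ->
  \sum_(i < d) Xvar i * mpoly.mderiv i Q = Q *+ k.
Proof.
move=> hQ.
have -> : Q *+ k = \sum_(m <- mpoly.msupp Q)
    (mpoly.mcoeff m Q *: mpoly.mpolyX R[i] m) *+ k.
  by rewrite sumrMnl -mpoly.mpolyE.
have hi i : Xvar i * mpoly.mderiv i Q = \sum_(m <- mpoly.msupp Q)
    (mpoly.mcoeff m Q *: mpoly.mpolyX R[i] m) *+ (m i).
  rewrite [in LHS](mpoly.mpolyE Q) linear_sum /= mulr_sumr; apply: eq_bigr => m _.
  rewrite mpoly.mderivZ mpoly.mderivX -scalerAr -scalerAr scalerMnr; congr (_ *: _).
  have [->|mi] := eqVneq (m i) 0%N; first by rewrite scale0r.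
  rewrite -mpoly.mpolyXD scaler_nat; congr (mpoly.mpolyX _ _ *+ _).
  apply/mpoly.mnmP => j; rewrite mpoly.mnmDE mpoly.mnmBE mpoly.mnm1E.
  by case: eqP => [<-|_] //=; rewrite ?add0n ?subn0 // subnKC // lt0n.
under eq_bigr do rewrite hi.
rewrite exchange_big /=; apply: eq_big_seq => m mQ.
by rewrite sumrMnr -mpoly.mdegE (mpoly.dhomog_mf hQ).
Qed.

Lemma harmonic_orthogonal_gaussian (G : cpoly R d -> R) k l P Q :
  {morph G : f g / f + g} ->
  (forall i f, G (Xvar i * f) *+ 2 = G (mpoly.mderiv i f)) ->
  harmonic_homogeneous k P -> harmonic_homogeneous l Q -> k != l ->
  G (P * Q) = 0.
Proof.
move=> GD GX [hP lP] [hQ lQ] kl.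
have G0 : G 0 = 0 by apply: (addrI (G 0)); rewrite -GD !addr0.
have Gsum (I : Type) (s : seq I) F : G (\sum_(i <- s) F i) = \sum_(i <- s) G (F i).
  exact: (big_morph G GD G0).
have GMn f n : G (f *+ n) = G f *+ n.
  by elim: n => [|n IH]; rewrite ?mulr0n // !mulrS GD IH.
(* By Euler, k' P' Q' is the sum of x_i P' d_i Q'. Trading x_i for a derivative with [GX] yields the
   sum on the right plus G of P' times the Laplacian of Q', which is 0. *)
have green k' P' Q' : harmonic_homogeneous k' Q' ->
    G (P' * Q') *+ k' *+ 2 =
    G (\sum_(i < d) mpoly.mderiv i P' * mpoly.mderiv i Q').
  move=> [hQ' lQ'].
  rewrite -GMn -mulrnAr -(euler_identity hQ') mulr_sumr Gsum -sumrMnl.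
  under eq_bigr do rewrite mulrCA GX mpoly.mderivM GD.
  by rewrite big_split /= -!Gsum -mulr_sumr [X in _ * X]lQ' mulr0 G0 addr0.
have e : G (P * Q) *+ k *+ 2 = G (P * Q) *+ l *+ 2.
  rewrite (green l P Q (conj hQ lQ)) [P * Q]mulrC (green k Q P (conj hP lP)); congr G.
  by apply: eq_bigr => i _; rewrite mulrC.
apply/eqP; move/eqP: e; rewrite -!mulrnA -subr_eq0.
move: (G (P * Q)) => z; clear -kl.
wlog le : k l kl / (l <= k)%N.
  move=> H; case/orP: (leq_total l k) => h; first exact: H.
  by rewrite -oppr_eq0 opprB; apply: H => //; rewrite eq_sym.
rewrite -mulrnBr ?leq_pmul2r // mulrn_eq0 -mulnBl muln_eq0 orbF subn_eq0.
by rewrite leqNgt ltn_neqAle eq_sym kl le.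
Qed.

End harmonic_orthogonality.

(** * Moments of the one-dimensional Gaussian *)

Section gaussian_moments.
Variable R : realType.
Local Notation mu := (@lebesgue_measure R).

Lemma expR_ge_pow (x : R) n : 0 <= x -> x ^+ n <= n`!%:R * expR x.
Proof.
move=> x0; rewrite mulrC -ler_pdivrMr ?ltr0n ?fact_gt0 //.
case: n => [|n]; first by rewrite expr0 fact0 divr1 (le_trans _ (expR_ge1Dx x)) ?lerDl.
by rewrite (le_trans _ (expR_ge1Dxn n x0)) ?lerDr.
Qed.

(** With y = x^2/2 the Gaussian is e^(-y) e^(-y). One factor absorbs the monomial, since |x|^n <= 1
    + (x^2)^n = 1 + 2^n y^n <= (1 + 2^n n!) e^y; the other is kept for integrability and decay. *)
Lemma monomial_gauss_bound n (x : R) :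
  `|x ^+ n * gauss_fun x| <= (1 + 2 ^+ n * n`!%:R) * expR (- (x ^+ 2 / 2)).
Proof.
set y := x ^+ 2 / 2.
have e0 : 0 <= y by rewrite divr_ge0 ?sqr_ge0.
have xy : x ^+ 2 = 2 * y by rewrite /y; lra.
have -> : gauss_fun x = expR (- y) * expR (- y).
  by rewrite /gauss_fun -expRD; congr expR; lra.
clearbody y.
rewrite !normrM !(ger0_norm (expR_ge0 _)) mulrA ler_wpM2r ?expR_ge0 //.
rewrite expRN ler_pdivrMr ?expR_gt0 // normrX mulrDl mul1r -mulrA.
apply: (@le_trans _ _ (1 + (x ^+ 2) ^+ n)).
  have [x1|x1] := lerP `|x| 1.
    have : `|x| ^+ n <= 1 by apply: exprn_ile1.
    by move/le_trans; apply; rewrite lerDl exprn_ge0 ?sqr_ge0.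
  have -> : (x ^+ 2) ^+ n = (`|x| ^+ n) ^+ 2.
    by rewrite -(real_normK (num_real x)) -!exprM mulnC.
  have := exprn_ege1 n (ltW x1); nra.
apply: lerD; first by rewrite -[leLHS]expR0 ler_expR.
by rewrite xy exprMn ler_pM2l ?exprn_gt0 //; exact: expR_ge_pow.
Qed.

Lemma measurable_monomial_gauss n :
  measurable_fun setT (fun x : R => x ^+ n * gauss_fun x).
Proof. by apply: measurable_funM => //; exact: measurable_gauss_fun. Qed.

Lemma integrable_monomial_gauss n :
  mu.-integrable setT (EFin \o (fun x => x ^+ n * gauss_fun x)).
Proof.
(* With this c the bound is c times the standard normal density, which is integrable. *)
pose c : R := (1 + 2 ^+ n * n`!%:R) / normal_peak 1.
have p0 : (0 : R) < normal_peak 1 by exact: normal_peak_gt0.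
have c0 : 0 <= c by rewrite divr_ge0 ?ltW // addr_gt0 // mulr_gt0 ?exprn_gt0 ?ltr0n ?fact_gt0.
apply: (@le_integrable _ _ R mu setT measurableT _ (fun x => (c%:E * (normal_pdf 0 1 x)%:E)%E)).
  by apply/measurable_EFinP; exact: measurable_monomial_gauss.
- move=> x _; rewrite -[(EFin \o _) x]/((x ^+ n * gauss_fun x)%:E) -EFinM !abse_EFin lee_fin.
  rewrite (le_trans (monomial_gauss_bound _ _)) //.
  rewrite [leRHS]ger0_norm ?mulr_ge0 ?normal_pdf_ge0 //.
  rewrite /c normal_pdfE ?oner_eq0 // -[leRHS]mulrA mulKf ?gt_eqF //.
    by rewrite /normal_fun subr0 expr1n mulNr.
  by rewrite invr_ge0 ltW.
- exact: (integrableZl measurableT c (integrable_normal_pdf 0 1)).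
Qed.

Definition gauss_moment n : R := Rintegral mu setT (fun x => x ^+ n * gauss_fun x).

(** The derivative of x^n e^(-x^2) integrates to 0 over the line. At n = 0 the truncated index n.-1
    is harmless, as its moment is multiplied by 0. *)
Lemma gauss_momentS n : gauss_moment n.+1 *+ 2 = gauss_moment n.-1 *+ n.
Proof.
pose F (x : R) := x ^+ n * gauss_fun x.
pose f (x : R) := (x ^+ n.-1 * gauss_fun x) *+ n - (x ^+ n.+1 * gauss_fun x) *+ 2.
have dF (x : R) : is_derive x (1 : R) F (f x).
  have dX (m : nat) : is_derive x (1 : R) (fun y : R => y ^+ m) (x ^+ m.-1 *+ m).
    have := is_deriveX m (is_derive_id x (1 : R)).
    by rewrite exprfctE /GRing.scale /= mulr1 mulr_natl.
  have dg : is_derive x (1 : R) (@gauss_fun R) (gauss_fun x * - (x *+ 2)).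
    apply: (@is_derive1_comp _ (@expR R) (fun y => - y ^+ 2)).
  have := is_deriveM (dX n) dg.
  rewrite mulrfctE /f /GRing.scale /=; congr is_derive.
  by rewrite !exprS !mulrnAr mulrN mulrnAr; ring.
have cf : continuous f.
  have cM m : continuous (fun x : R => x ^+ m * gauss_fun x).
    by move=> x; apply: cvgM; [exact: exprn_continuous|exact: continuous_gauss_fun].
  move=> x; apply: cvgB.
    by apply: (@cvgMn R^o); exact: cM.
  by apply: (@cvgMn R^o); exact: cM.
pose c : R := 1 + 2 ^+ n * n`!%:R.
have c0 : 0 <= c by rewrite addr_ge0 // mulr_ge0 ?exprn_ge0.
have fE : EFin \o f = (fun x => (n%:R)%:E * (x ^+ n.-1 * gauss_fun x)%:E -
    2%:E * (x ^+ n.+1 * gauss_fun x)%:E)%E.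
  by apply/funext => x; rewrite -!EFinM -EFinB !mulr_natl.
have intf : mu.-integrable setT (EFin \o f).
  rewrite fE; apply: integrableB => //.
    exact: (integrableZl measurableT _ (integrable_monomial_gauss n.-1)).
  exact: (integrableZl measurableT _ (integrable_monomial_gauss n.+1)).
have If : Rintegral mu setT f = gauss_moment n.-1 *+ n - gauss_moment n.+1 *+ 2.
  have -> : f = fun x => n%:R * (x ^+ n.-1 * gauss_fun x) - 2 * (x ^+ n.+1 * gauss_fun x).
    by apply/funext => x; rewrite /f !mulr_natl.
  rewrite RintegralB //; last 2 first.
  - exact: (integrableZl measurableT _ (integrable_monomial_gauss n.-1)).
  - exact: (integrableZl measurableT _ (integrable_monomial_gauss n.+1)).
  by rewrite !RintegralZl //; [rewrite !mulr_natl|exact: integrable_monomial_gauss..].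
suff : Rintegral mu setT f = 0 by rewrite If => /eqP; rewrite subr_eq0 => /eqP.
(* On these growing intervals the integral of f is a boundary term, which tends to 0, while
   dominated convergence sends it to the integral over the line. *)
pose D k : set R := [set` `[(- (k.+1%:R) : R), k.+1%:R]].
have cF : continuous F.
  by move=> x; apply: differentiable_continuous; apply/derivable1_diffP; have [] := dF x.
have ftc k : (\int[mu]_(x in D k) (f x)%:E = (F k.+1%:R - F (- k.+1%:R))%:E)%E.
  rewrite (@continuous_FTC2 R f F) -?EFinB //.
  - by rewrite gtrN // ltr0n.
  - exact: continuous_subspaceT.
  - split.
    + by move=> x _; have [] := dF x.
    + by apply: cvg_at_right_filter; exact: cF.
    + by apply: cvg_at_left_filter; exact: cF.
  - by move=> x _; rewrite derive1E; have [] := dF x.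
have lim1 : (\int[mu]_(x in D k) (f x)%:E)%E @[k --> \oo] --> (\int[mu]_x (f x)%:E)%E.
  have mf : measurable_fun setT (EFin \o f) by exact: measurable_int intf.
  have [] := @dominated_convergence _ _ R mu setT measurableT
    (fun k => (EFin \o f) \_ (D k)) (EFin \o f) (abse \o (EFin \o f)).
  - move=> k; apply: (measurable_restrictT (EFin \o f) (measurable_itv _)).1.
    exact: (measurable_funS measurableT (@subsetT _ _) mf).
  - exact: mf.
  - apply: aeW => x _; apply: cvg_near_cst.
    near=> k; rewrite patchE ifT // inE /D /= in_itv /= -ler_norml.
    near: k; apply: filterS (nbhs_infty_ger `|x|) => k /le_trans; apply.
    by rewrite ler_nat.
  - exact: integrable_abse.
  - apply: aeW => x k _; rewrite patchE; case: ifP => // _.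
    by rewrite abse0 abse_ge0.
  - move=> _ _; apply: cvg_trans; apply: near_eq_cvg; apply: nearW => k.
    by rewrite [RHS]integral_mkcond.
have lim2 : F k.+1%:R - F (- k.+1%:R) @[k --> \oo] --> (0 : R).
  (* Since e^(y^2/2) >= 1 + y^2/2 >= |y|, the Gaussian bound decays at least like 1/|y|. *)
  have Fb (y : R) : 0 < `|y| -> `|F y| <= c * `|y|^-1.
    move=> y0; apply: (le_trans (monomial_gauss_bound n y)).
    rewrite ler_wpM2l // expRN lef_pV2 ?posrE ?expR_gt0 //.
    apply: le_trans (expR_ge1Dx _); rewrite -(real_normK (num_real y)); nra.
  apply: norm_cvg0.
  apply: (@squeeze_cvgr _ _ _ _ (cst 0) (fun k => (c *+ 2) * harmonic k)).
  - apply: nearW => k; rewrite normr_ge0 /= (le_trans (ler_normB _ _)) //.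
    have := Fb k.+1%:R; have := Fb (- k.+1%:R).
    rewrite normrN normr_nat ltr0n => /(_ isT) + /(_ isT).
    by move=> h1 h2; rewrite /harmonic /= mulr2n mulrDl; exact: lerD.
  - exact: cvg_cst.
  - rewrite -[X in _ --> X](mulr0 (c *+ 2)); apply: cvgMl_tmp; exact: cvg_harmonic.
have lim2' : (\int[mu]_(x in D k) (f x)%:E)%E @[k --> \oo] --> (0 : R)%:E.
  under eq_fun do rewrite ftc.
  by apply: cvg_EFin => //; apply: nearW.
have /(@cvg_unique _ (@ereal_hausdorff R)) e := lim1.
by rewrite /Rintegral (e _ lim2').
Unshelve. all: by end_near.
Qed.

End gaussian_moments.

Section image_measure_integral.
Context d1 d2 (T1 : measurableType d1) (T2 : measurableType d2) (R : realType).
Variables (m : {measure set T1 -> \bar R}) (phi : T1 -> T2).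
Hypothesis mphi : measurable_fun setT phi.
Local Open Scope ereal_scope.

Lemma ge0_integral_image (f : T2 -> \bar R) :
  measurable_fun setT f -> (forall x, 0 <= f x) ->
  \int[image_measure m mphi]_y f y = \int[m]_x f (phi x).
Proof.
by move=> mf f0; rewrite (ge0_integral_pushforward mphi).
Qed.

Lemma integrable_image (f : T2 -> \bar R) : measurable_fun setT f ->
  m.-integrable setT (f \o phi) -> (image_measure m mphi).-integrable setT f.
Proof.
move=> mf /integrableP [_ foo]; apply/integrableP; split => //.
rewrite ge0_integral_image //; exact: measurableT_comp.
Qed.

Lemma Rintegral_image (f : T2 -> R) : measurable_fun setT f ->
  Rintegral (image_measure m mphi) setT f = Rintegral m setT (f \o phi).
Proof.
move=> /measurable_EFinP mf; rewrite /Rintegral integralE [in RHS]integralE.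
rewrite !ge0_integral_image //; last 2 first.
- exact: measurable_funeneg.
- exact: measurable_funepos.
by congr (fine (_ - _)); apply: eq_integral => x _; rewrite ?funeposE ?funenegE.
Qed.

End image_measure_integral.

(** * Lebesgue measure on tuples through Fubini *)

Section lebesgue_tuple.
Variable R : realType.
Local Notation mu := (@lebesgue_measure R).
Local Open Scope ereal_scope.

Lemma ge0_integral_lebesgueS n (f : n.+1.-tuple R -> \bar R) :
  measurable_fun setT f -> (forall x, 0 <= f x) ->
  \int[lebesgue R n.+1]_x f x =
  \int[mu]_y \int[lebesgue R n]_x f (Defs.cons_tuple (y, x)).
Proof.
move=> mf f0; rewrite ge0_integral_image // (fubini_tonelli1 (f \o @Defs.cons_tuple R n)) //.
  exact: measurableT_comp mf (@measurable_cons_tuple R n).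
by move=> x; exact: f0.
Qed.

Lemma tnth_cons_tuple0 n (y : R) (x : n.-tuple R) :
  tnth (Defs.cons_tuple (y, x)) ord0 = y.
Proof. exact: tnth0. Qed.

Lemma tnth_cons_tupleS n (y : R) (x : n.-tuple R) i :
  tnth (Defs.cons_tuple (y, x)) (lift ord0 i) = tnth x i.
Proof. exact: tnthS. Qed.

Lemma measurable_tuple_prod n (f : 'I_n -> R -> R) :
  (forall i, measurable_fun setT (f i)) ->
  measurable_fun setT (fun x : n.-tuple R => \prod_(i < n) f i (tnth x i))%R.
Proof.
move=> mf; apply: measurable_prod => i _.
by apply: measurableT_comp (mf i) _; exact: measurable_tnth.
Qed.

(** Integrability and value are carried through one induction, because Fubini for the head
    coordinate uses the integrability of the tail. *)
Lemma lebesgue_tuple_prod n (f : 'I_n -> R -> R) :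
  (forall i, mu.-integrable setT (EFin \o f i)) ->
  (lebesgue R n).-integrable setT
    (EFin \o (fun x => \prod_(i < n) f i (tnth x i))%R) /\
  Rintegral (lebesgue R n) setT (fun x => \prod_(i < n) f i (tnth x i))%R =
  (\prod_(i < n) Rintegral mu setT (f i))%R.
Proof.
elim: n f => [|n IH] f fint.
  rewrite (_ : (fun _ => _) = cst 1%R); last first.
    by apply/funext => x; rewrite big_ord0.
  rewrite big_ord0; split.
    apply/integrableP; split; first by apply/measurable_EFinP; exact: measurable_cst.
    by rewrite /= (@integral_dirac _ _ _ R setT measurableT) // diracE in_setT mul1e normr1 ltry.
  rewrite /Rintegral (_ : \int[lebesgue R 0]_x _ =
    \int[dirac ([tuple] : 0.-tuple R)]_x (cst 1%:E x)) //.
  by rewrite integral_dirac // diracE in_setT mul1e.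
have mf i : measurable_fun setT (f i).
  by apply/measurable_EFinP; exact: measurable_int (fint i).
have [gint gE] := IH (fun i => f (lift ord0 i)) (fun i => fint _).
set g := (fun x : n.-tuple R => _) in gint gE.
have mg : measurable_fun setT g by exact: (measurable_tuple_prod (fun i => mf (lift ord0 i))).
have fE : (fun x : n.+1.-tuple R => \prod_(i < n.+1) f i (tnth x i))%R \o @Defs.cons_tuple R n
    = (fun z : measurableTypeR R * n.-tuple R => f ord0 z.1 * g z.2)%R.
  apply/funext => -[y x] /=; rewrite big_ord_recl tnth_cons_tuple0; congr (_ * _)%R.
  by apply: eq_bigr => i _; rewrite tnth_cons_tupleS.
have pint : (mu \x lebesgue R n).-integrable setT
    (EFin \o (fun z : measurableTypeR R * n.-tuple R => f ord0 z.1 * g z.2)%R).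
  apply/integrable12ltyP.
    apply/measurable_EFinP; apply: measurable_funM.
      exact: measurableT_comp (mf _) measurable_fst.
    exact: measurableT_comp mg measurable_snd.
  have /integrableP [_ foo] := fint ord0.
  have /integrableP [mg' goo] := gint.
  under eq_integral => y _.
    under eq_integral => x _ do rewrite /= normrM EFinM.
    rewrite ge0_integralZl //; last by apply/measurable_EFinP; exact: measurableT_comp.
    over.
  rewrite ge0_integralZr //=; last by exact: integral_ge0.
    by apply: lte_mul_pinfty => //; [exact: integral_ge0| rewrite ge0_fin_numE // integral_ge0].
  by apply/measurable_EFinP; apply: measurableT_comp (mf _).
split.
  apply: integrable_image; first by apply/measurable_EFinP; exact: measurable_tuple_prod.
  by move: pint; rewrite -fE.
rewrite Rintegral_image; last exact: measurable_tuple_prod.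
rewrite fE big_ord_recl -gE /Rintegral -integral12_prod_meas1 //= /fubini_F.
under eq_integral => y _.
  under eq_integral => x _ do rewrite /= EFinM.
  rewrite integralZl // -(fineK (integrable_fin_num measurableT gint)).
  over.
rewrite integralZr //; last exact: fint.
by rewrite fineM //; exact: (integrable_fin_num measurableT (fint ord0)).
Qed.

End lebesgue_tuple.

Definition dilation (R : realType) d (r : R) (x : d.-tuple R) : d.-tuple R :=
  [tuple r * tnth x i | i < d].

(** * Values of polynomials and their Gaussian integrals *)

Section ceval_lemmas.
Variables (R : realType) (d : nat).
Implicit Types (f g : cpoly R d) (x : d.-tuple R).

Lemma cevalD f g x : ceval (f + g) x = ceval f x + ceval g x.
Proof. exact: mpoly.mevalD. Qed.

Lemma cevalM f g x : ceval (f * g) x = ceval f x * ceval g x.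
Proof. exact: mpoly.mevalM. Qed.

Lemma Re_mul_real (z w : R[i]) : complex.Im w = 0 ->
  complex.Re (z * w) = complex.Re z * complex.Re w.
Proof. by case: z w => a b [c e] /= ->; rewrite mulr0 subr0. Qed.

Lemma Re_ceval f x : complex.Re (ceval f x) =
  \sum_(m <- mpoly.msupp f)
    complex.Re (mpoly.mcoeff m f) * \prod_(i < d) tnth x i ^+ m i.
Proof.
rewrite /ceval mpoly.mevalE raddf_sum; apply: eq_bigr => m _.
have -> : \prod_(i < d) (Complex (tnth x i) 0) ^+ m i =
    (\prod_(i < d) tnth x i ^+ m i)%:C%C.
  by rewrite rmorph_prod; apply: eq_bigr => i _; rewrite rmorphXn.
by rewrite /= Re_mul_real.
Qed.


Lemma measurable_Re_ceval f :
  measurable_fun setT (fun x : d.-tuple R => complex.Re (ceval f x)).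
Proof.
under eq_fun do rewrite Re_ceval.
apply: measurable_sum => m; apply: measurable_funM => //.
apply: (@measurable_tuple_prod R d (fun i y => y ^+ m i)) => i.
exact: exprn_measurable.
Qed.



Lemma ceval_homogeneous k f (r : R) x : f \is mpoly.ishomog1 k mpoly.mdeg ->
  complex.Re (ceval f (dilation r x)) = r ^+ k * complex.Re (ceval f x).
Proof.
move=> hf; rewrite !Re_ceval mulr_sumr; apply: eq_big_seq => m mf.
rewrite mulrCA; congr (_ * _).
under eq_bigr do rewrite tnth_mktuple exprMn.
rewrite big_split /=; congr (_ * _).
by rewrite prodrXr -mpoly.mdegE (mpoly.dhomog_mf hf).
Qed.

(** [msize] exceeds every degree that occurs in f, so each power of r is at most 1 when r <= 1 and
    at most r^N otherwise. *)
Lemma Re_ceval_bound f : exists C (N : nat), 0 <= C /\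
  forall r x, 0 <= r -> (forall i, `|tnth x i| <= 1) ->
  `|complex.Re (ceval f (dilation r x))| <= C * (1 + r ^+ N).
Proof.
exists (\sum_(m <- mpoly.msupp f) `|complex.Re (mpoly.mcoeff m f)|).
exists (mpoly.msize f); split => [|r x r0 x1]; first exact: sumr_ge0.
rewrite Re_ceval (le_trans (ler_norm_sum _ _ _)) // mulr_suml.
rewrite big_seq [leRHS]big_seq; apply: ler_sum => m mf.
rewrite normrM ler_wpM2l // normr_prod.
apply: (@le_trans _ _ (\prod_(i < d) r ^+ m i)).
  apply: ler_prod => i _; rewrite normr_ge0 /= tnth_mktuple normrX normrM ger0_norm //.
  by rewrite lerXn2r ?nnegrE ?mulr_ge0 // ler_piMr.
rewrite prodrXr -mpoly.mdegE.
have [r1|r1] := lerP r 1.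
  by rewrite (le_trans (exprn_ile1 _ r0 r1)) // lerDl exprn_ge0.
rewrite (le_trans (_ : _ <= r ^+ mpoly.msize f)) ?lerDr //.
by rewrite ler_weXn2l ?(ltW r1) // ltnW // mpoly.msize_mdeg_lt.
Qed.

Local Notation Xvar i := (mpoly.mpolyX R[i] (mpoly.mnm1 i)).

(** The weight is e^(-|x|^2), written as a product so that monomials factor into one-dimensional
    moments; [prod_gauss_enorm] gives back the radial form. *)
Definition gauss_functional f : R := Rintegral (lebesgue R d) setT
  (fun x => complex.Re (ceval f x) * \prod_(i < d) gauss_fun (tnth x i)).

Lemma monomial_gaussE (m : mpoly.multinom d) (x : d.-tuple R) :
  (\prod_(i < d) tnth x i ^+ m i) * \prod_(i < d) gauss_fun (tnth x i) =
  \prod_(i < d) (fun y => y ^+ m i * gauss_fun y) (tnth x i).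
Proof. by rewrite -big_split. Qed.

Lemma integrable_gauss_functional f : (lebesgue R d).-integrable setT (EFin \o
  (fun x => complex.Re (ceval f x) * \prod_(i < d) gauss_fun (tnth x i))).
Proof.
under [X in EFin \o X]eq_fun => x.
  rewrite Re_ceval mulr_suml.
  under eq_bigr do rewrite -mulrA monomial_gaussE.
  over.
rewrite (_ : EFin \o _ = fun x => (\sum_(m <- mpoly.msupp f)
  (complex.Re (mpoly.mcoeff m f) *
   \prod_(i < d) (fun y => y ^+ m i * gauss_fun y) (tnth x i))%:E)%E); last first.
  by apply/funext => x; rewrite /= sumEFin.
apply: integrable_sum => // m _.
under eq_fun do rewrite EFinM.
apply: integrableZl => //.
by have [] := lebesgue_tuple_prod (fun i => @integrable_monomial_gauss R (m i)).
Qed.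

Lemma gauss_functionalD : {morph gauss_functional : f g / f + g}.
Proof.
move=> f g; rewrite /gauss_functional -RintegralD //; try exact: integrable_gauss_functional.
by apply: eq_Rintegral => x _; rewrite cevalD raddfD mulrDl.
Qed.

Lemma gauss_functional_monomial c (m : mpoly.multinom d) :
  gauss_functional (c *: mpoly.mpolyX R[i] m) =
  complex.Re c * \prod_(i < d) gauss_moment R (m i).
Proof.
have [iX eX] := lebesgue_tuple_prod (fun i => @integrable_monomial_gauss R (m i)).
rewrite -eX -RintegralZl //; apply: eq_Rintegral => x _.
rewrite /ceval mpoly.mevalZ mpoly.mevalX.
have -> : \prod_(i < d) (Complex (tnth x i) 0) ^+ m i =
    (\prod_(i < d) tnth x i ^+ m i)%:C%C.
  by rewrite rmorph_prod; apply: eq_bigr => i _; rewrite rmorphXn.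
by rewrite Re_mul_real // -mulrA monomial_gaussE.
Qed.

(** By additivity only monomials matter; there it is [gauss_momentS] at the exponent m i in the i-th
    factor, the other factors being unchanged. *)
Lemma gauss_functional_deriv i f :
  gauss_functional (Xvar i * f) *+ 2 = gauss_functional (mpoly.mderiv i f).
Proof.
have G0 : gauss_functional 0 = 0.
  by apply: (addrI (gauss_functional 0)); rewrite -gauss_functionalD !addr0.
rewrite (mpoly.mpolyE f) linear_sum mulr_sumr.
rewrite !(big_morph _ gauss_functionalD G0) -sumrMnl; apply: eq_bigr => m _.
rewrite -scalerAr -mpoly.mpolyXD /= mpoly.mderivZ mpoly.mderivX scalerA.
rewrite !gauss_functional_monomial.
rewrite !(bigD1 i (P := xpredT)) //= mpoly.mnmDE mpoly.mnmBE !mpoly.mnm1E eqxx.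
rewrite add1n subn1 -mulrnAr -mulrnAl gauss_momentS.
rewrite mulr_natr raddfMn /= !mulrnAl mulrnAr; congr (_ * (_ * _) *+ _).
apply: eq_bigr => j ji.
by rewrite mpoly.mnmDE mpoly.mnmBE !mpoly.mnm1E eq_sym (negbTE ji) subn0.
Qed.

Lemma harmonic_orthogonal_gauss k l f g :
  harmonic_homogeneous k f -> harmonic_homogeneous l g -> k != l ->
  gauss_functional (f * g) = 0.
Proof.
apply: (harmonic_orthogonal_gaussian gauss_functionalD) => i h.
exact: gauss_functional_deriv.
Qed.

End ceval_lemmas.

(** * Polar coordinates *)

Section dilation_lebesgue.
Variable R : realType.
Local Notation mu := (@lebesgue_measure R).
Local Open Scope ereal_scope.

(** r times the image of Lebesgue measure under y -> r y gives every interval its length, hence is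
    Lebesgue measure. *)
Lemma ge0_integral_lebesgue_dilation1 (r : R) (f : R -> \bar R) : (0 < r)%R ->
  measurable_fun setT f -> (forall y, 0 <= f y) ->
  r%:E * \int[mu]_y f (r * y)%R = \int[mu]_y f y.
Proof.
move=> r0 mf f0.
have mr : measurable_fun setT (fun y : measurableTypeR R => (r * y)%R : measurableTypeR R).
  exact: measurable_funM.
pose m : {measure set (measurableTypeR R) -> \bar R} :=
  mscale (NngNum (ltW r0)) (image_measure mu mr).
have mE A : measurable A -> mu A = m A.
  apply: lebesgue_measure_unique => _ [[a b] _ <-] /=.
  rewrite /m /mscale /= /image_measure /pushforward.
  rewrite (_ : _ @^-1` _ = `](a / r)%R, (b / r)%R]%classic); last first.
    apply/seteqP; split => y /=; rewrite !in_itv /= ltr_pdivrMr // ler_pdivlMr //.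
      by rewrite mulrC.
    by rewrite mulrC.
  rewrite !lebesgue_measure_itv /= !lte_fin ltr_pM2r ?invr_gt0 //.
  case: ifPn => _; last by rewrite mule0.
  by rewrite -!EFinB -EFinM -mulrBl mulrC mulfVK // gt_eqF.
rewrite [RHS](eq_measure_integral m) => [|A mA _]; last exact: mE.
by rewrite ge0_integral_mscale // ge0_integral_image.
Qed.

Lemma measurable_dilation d (r : R) : measurable_fun setT (@dilation R d r).
Proof.
apply/measurable_fun_tnthP => i.
rewrite (_ : _ \o _ = fun x : d.-tuple R => (r * tnth x i)%R); last first.
  by apply/funext => x /=; rewrite tnth_mktuple.
by apply: measurable_funM => //; exact: measurable_tnth.
Qed.

Lemma dilation_cons n (r y : R) (x : n.-tuple R) :
  dilation r (Defs.cons_tuple (y, x)) = Defs.cons_tuple ((r * y)%R, dilation r x).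
Proof.
apply: eq_from_tnth => i; rewrite tnth_mktuple.
case: (unliftP ord0 i) => [j|] ->; last by rewrite !tnth_cons_tuple0.
by rewrite !tnth_cons_tupleS tnth_mktuple.
Qed.

Lemma ge0_integral_lebesgue_dilation n (r : R) (f : n.-tuple R -> \bar R) :
  (0 < r)%R -> measurable_fun setT f -> (forall y, 0 <= f y) ->
  (r ^+ n)%:E * \int[lebesgue R n]_x f (dilation r x) = \int[lebesgue R n]_x f x.
Proof.
move=> r0; elim: n f => [|n IH] f mf f0.
  rewrite mul1e; apply: eq_integral => x _; congr f.
  by apply: eq_from_tnth => -[].
have mfd : measurable_fun setT (f \o @dilation R n.+1 r).
  exact: measurableT_comp mf (measurable_dilation _).
have mfc : measurable_fun setT (f \o @Defs.cons_tuple R n).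
  exact: measurableT_comp mf (@measurable_cons_tuple R n).
rewrite !ge0_integral_lebesgueS //.
pose H y := \int[lebesgue R n]_x f (Defs.cons_tuple (y, x)).
have mH : measurable_fun setT H.
  exact: (measurable_fun_fubini_tonelli_F (f \o @Defs.cons_tuple R n) mfc (fun z => f0 _)).
have H0 y : 0 <= H y by exact: integral_ge0.
have mfy y : measurable_fun setT (fun x : n.-tuple R => f (Defs.cons_tuple (y, x))).
  exact: measurableT_comp mfc (pair1_measurable y).
rewrite -[RHS](ge0_integral_lebesgue_dilation1 r0 mH H0).
rewrite exprS EFinM -muleA; congr (_ * _).
rewrite -ge0_integralZl ?lee_fin ?exprn_ge0 ?(ltW r0) //; last 2 first.
- exact: (measurable_fun_fubini_tonelli_F (f \o @dilation R n.+1 r \o @Defs.cons_tuple R n)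
   (measurableT_comp mfd (@measurable_cons_tuple R n)) (fun z => f0 _)).
- by move=> y _; exact: integral_ge0.
apply: eq_integral => y _; rewrite /H -(IH _ (mfy _)) //.
by congr (_ * _); apply: eq_integral => x _; rewrite dilation_cons.
Qed.

End dilation_lebesgue.

Section enorm_lemmas.
Variables (R : realType) (d : nat).
Implicit Type x : d.-tuple R.

Lemma measurable_enorm : measurable_fun setT (@enorm R d).
Proof.
apply: measurableT_comp; first exact: measurable_sqrt.
by apply: measurable_sum => i; apply: measurable_funX; exact: measurable_tnth.
Qed.

Lemma enorm_ge0 x : 0 <= enorm x. Proof. exact: sqrtr_ge0. Qed.

Lemma sqr_enorm x : enorm x ^+ 2 = \sum_(i < d) tnth x i ^+ 2.
Proof. by rewrite sqr_sqrtr // sumr_ge0 // => i _; exact: sqr_ge0. Qed.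

Lemma enorm_dilation r x : 0 <= r -> enorm (dilation r x) = r * enorm x.
Proof.
move=> r0; rewrite /enorm.
under eq_bigr do rewrite tnth_mktuple exprMn.
by rewrite -mulr_sumr sqrtrM ?sqr_ge0 // sqrtr_sqr ger0_norm.
Qed.

Lemma direction_dilation r x : 0 < r -> direction (dilation r x) = direction x.
Proof.
move=> r0; apply: eq_from_tnth => i; rewrite !tnth_mktuple enorm_dilation ?ltW //.
by rewrite invfM mulrACA divff ?mul1r // gt_eqF.
Qed.

Lemma dilation_direction x : 0 < enorm x -> dilation (enorm x) (direction x) = x.
Proof.
move=> x0; apply: eq_from_tnth => i; rewrite !tnth_mktuple.
by rewrite mulrCA divff ?mulr1 // gt_eqF.
Qed.

Lemma enorm_direction x : 0 < enorm x -> enorm (direction x) = 1.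
Proof.
move=> x0; have x0' : enorm x != 0 by rewrite gt_eqF.
by apply: (mulfI x0'); rewrite -enorm_dilation ?ltW // dilation_direction ?mulr1.
Qed.

Lemma ler_tnth_enorm x i : `|tnth x i| <= enorm x.
Proof.
rewrite -sqrtr_sqr ler_wsqrtr // (bigD1 i) //= lerDl sumr_ge0 // => j _.
exact: sqr_ge0.
Qed.

Lemma prod_gauss_enorm x :
  \prod_(i < d) gauss_fun (tnth x i) = gauss_fun (enorm x).
Proof.
by rewrite /gauss_fun -expR_sum sumrN -sqr_enorm.
Qed.

End enorm_lemmas.

Section measure_lemmas.
Context d (T : measurableType d) (R : realType).
Local Open Scope ereal_scope.

Lemma ge0_integral_mrestr (mu : {measure set T -> \bar R}) (D : set T)
    (mD : measurable D) (f : T -> \bar R) :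
  measurable_fun setT f -> (forall x, 0 <= f x) ->
  \int[mrestr mu mD]_x f x = \int[mu]_(x in D) f x.
Proof.
move=> mf f0; rewrite -(setUv D) ge0_integral_setU //; last 3 first.
- exact: measurableC.
- by rewrite setUv.
- exact/disj_setPCl.
rewrite (eq_measure_integral mu); last first.
  by move=> A mA AD; rewrite /= /mrestr setIidl.
rewrite [X in _ + X](eq_measure_integral mzero); last first.
  move=> A mA AD; rewrite /= /mrestr /mzero (_ : _ `&` _ = set0) ?measure0 //.
  by apply/disjoints_subset.
by rewrite integral_measure_zero adde0.
Qed.

(** These rays are closed under intersection and are the sets whose sectors have known volume, so
    they serve as the generator for [measure_unique] in [polar_uniqueness]. *)
Lemma measurable_gen_itvNyc :
  @measurable _ (measurableTypeR R) =
  <<s [set A : set R | exists x, A = `]-oo, x]%classic] >>.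
Proof.
rewrite [LHS](RGenOInfty.measurableE R); apply/seteqP; split.
  apply: smallest_sub; first exact: smallest_sigma_algebra.
  move=> _ [x ->]; rewrite -setCitvl.
  have := @smallest_sigma_algebra _ setT [set A : set R | exists x, A = `]-oo, x]%classic].
  move=> [_ hC _]; rewrite -setTD; apply: hC.
  by apply: sub_sigma_algebra; exists x.
rewrite -(RGenOInfty.measurableE R).
apply: smallest_sub.
  exact: sigma_algebra_measurable.
by move=> _ [x ->]; exact: measurable_itv.
Qed.

End measure_lemmas.

Section polar.
Variables (R : realType) (d : nat).
Local Notation La := (lebesgue R d).
Local Open Scope ereal_scope.

(** The surface measure before multiplication by d. *)
Definition direction_measure : {measure set (d.-tuple R) -> \bar R} :=
  image_measure (mrestr La (@measurable_punctured_ball R d))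
                (@measurable_direction R d).

Definition punctured : set (d.-tuple R) := [set x | 0 < enorm x]%R.

Lemma measurable_punctured : measurable punctured.
Proof.
rewrite (_ : punctured = @enorm R d @^-1` `]0%R, +oo[); last first.
  by apply/seteqP; split => x /=; rewrite in_itv /= andbT.
by rewrite -[X in measurable X]setTI; exact: (@measurable_enorm R d).
Qed.

Lemma measurable_preimage_direction A :
  measurable A -> measurable (@direction R d @^-1` A).
Proof.
by move=> mA; rewrite -[X in measurable X]setTI; exact: measurable_direction.
Qed.

Lemma measurable_preimage_enorm (B : set (measurableTypeR R)) :
  measurable B -> measurable (@enorm R d @^-1` B).
Proof.
by move=> mB; rewrite -[X in measurable X]setTI; exact: measurable_enorm.
Qed.

(** The sector of radius r is the dilate by r of the sector of radius 1, whose volume is the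
    direction measure of A. *)
Lemma lebesgue_sector (A : set (d.-tuple R)) (r : R) : measurable A -> (0 < r)%R ->
  La (@enorm R d @^-1` `]-oo, r] `&` (punctured `&` @direction R d @^-1` A)) =
  (r ^+ d)%:E * direction_measure A.
Proof.
move=> mA r0.
have mS (s : R) : measurable
    (@enorm R d @^-1` `]-oo, s] `&` (punctured `&` @direction R d @^-1` A)).
  apply: measurableI; first by apply: measurable_preimage_enorm; exact: measurable_itv.
  apply: measurableI; first exact: measurable_punctured.
  exact: measurable_preimage_direction.
have ind S : measurable S -> La S = \int[La]_x (\1_S x)%:E.
  by move=> mS'; rewrite integral_indic // setIT.
rewrite ind // -(ge0_integral_lebesgue_dilation r0); last 2 first.
- by apply/measurable_EFinP; exact: measurable_indic.
- by move=> x; rewrite lee_fin.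
congr (_ * _).
rewrite /direction_measure /image_measure /pushforward /= /mrestr.
have -> : @direction R d @^-1` A `&` @punctured_ball R d =
   @enorm R d @^-1` `]-oo, 1%R] `&` (punctured `&` @direction R d @^-1` A).
  apply/seteqP; split => x /=; rewrite in_itv /= /punctured /punctured_ball /=.
    by move=> [? /andP[? ?]].
  by move=> [? [? ?]]; split => //; apply/andP.
rewrite ind //.
apply: eq_integral => x _; congr EFin; rewrite !indicE; congr (_ %:R); congr nat_of_bool.
apply/idP/idP; rewrite !inE /= !in_itv /= /punctured /= enorm_dilation ?(ltW r0) //.
  rewrite direction_dilation // pmulr_rgt0 // => -[h1 h2]; split => //.
  by move: h1; rewrite -[X in (_ <= X)%R]mulr1 ler_pM2l.
rewrite direction_dilation // pmulr_rgt0 // => -[h1 h2]; split => //.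
by rewrite -[X in (_ <= X)%R]mulr1 ler_pM2l.
Qed.

Lemma direction_measure_le A : measurable A ->
  direction_measure A <= direction_measure setT.
Proof. by move=> mA; apply: le_measure; rewrite ?inE. Qed.

(** On the unit ball 1 <= e e^(-|x|^2), and the Gaussian is integrable. *)
Lemma direction_measure_fin : direction_measure setT < +oo.
Proof.
have [ig _] := lebesgue_tuple_prod (fun _ : 'I_d => @integrable_monomial_gauss R 0).
have mPB := @measurable_punctured_ball R d.
rewrite /direction_measure /image_measure /pushforward /= /mrestr preimage_setT setTI.
rewrite -[X in La X]setIT -integral_indic //.
have /integrableP [mg goo] := integrableZl measurableT (expR 1) ig.
apply: le_lt_trans goo; apply: ge0_le_integral => //.
- by apply/measurable_EFinP; exact: measurable_indic.
- exact: measurableT_comp.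
move=> x _; rewrite /= normrM !ger0_norm ?expR_ge0 ?prodr_ge0 //; last first.
  by move=> i _; rewrite expr0 mul1r gauss_fun_ge0.
rewrite lee_fin indicE; case: (boolP (x \in _)) => [|_]; last first.
  by rewrite mulr_ge0 ?expR_ge0 // prodr_ge0 // => i _; rewrite expr0 mul1r gauss_fun_ge0.
rewrite inE /punctured_ball /= => /andP [x0 x1].
under eq_bigr do rewrite expr0 mul1r.
rewrite prod_gauss_enorm /gauss_fun -expRD -[leLHS]expR0 ler_expR.
by rewrite subr_ge0 expr_le1 // ltW.
Qed.

(** Radius and direction are independent. For fixed A the distribution of the radius over the sector
    of A gives ]-oo, r] the mass r^d times the direction measure of A, so the distributions for A
    and for the whole space are proportional. Cross-multiplying avoids division by a total mass that
    could be 0. *)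
Lemma polar_uniqueness A (phi : R -> R) : measurable A ->
  measurable_fun setT phi -> (forall r, (0 <= phi r)%R) ->
  direction_measure setT *
    \int[La]_(x in punctured `&` @direction R d @^-1` A) (phi (enorm x))%:E =
  direction_measure A * \int[La]_(x in punctured) (phi (enorm x))%:E.
Proof.
move=> mA mphi phi0.
have mD B : measurable B -> measurable (punctured `&` @direction R d @^-1` B).
  by move=> mB; apply: measurableI; [exact: measurable_punctured|
    exact: measurable_preimage_direction].
have men : measurable_fun setT (@enorm R d : d.-tuple R -> measurableTypeR R).
  exact: measurable_enorm.
pose M B mB : {measure set (measurableTypeR R) -> \bar R} :=
  image_measure (mrestr La (mD B mB)) men.
have ME B mB : \int[M B mB]_r (phi r)%:E =
    \int[La]_(x in punctured `&` @direction R d @^-1` B) (phi (enorm x))%:E.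
  rewrite ge0_integral_image //; last by apply/measurable_EFinP.
  rewrite ge0_integral_mrestr //; last by move=> x; rewrite lee_fin.
  apply/measurable_EFinP; exact: measurableT_comp mphi (@measurable_enorm R d).
have fin B : measurable B -> direction_measure B \is a fin_num.
  move=> mB; rewrite ge0_fin_numE //.
  exact: le_lt_trans (direction_measure_le mB) direction_measure_fin.
have fT := fin _ measurableT; have fA := fin _ mA.
pose c B : {nonneg R} := NngNum (fine_ge0 (measure_ge0 direction_measure B)).
have Moo (B : set (d.-tuple R)) (mB : measurable B) (r : R) :
    M B mB `]-oo, r]%classic = (if (0 < r)%R then (r ^+ d)%:E * direction_measure B else 0).
  rewrite /M /image_measure /pushforward /= /mrestr.
  case: ifPn => r0; first exact: lebesgue_sector.
  rewrite (_ : _ `&` _ = set0) ?measure0 //.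
  apply/seteqP; split => x //= [+ [+ _]]; rewrite in_itv /= /punctured /= => h1 h2.
  by move: r0; rewrite (lt_le_trans h2 h1).
pose m1 : {measure set (measurableTypeR R) -> \bar R} := mscale (c setT) (M A mA).
pose m2 : {measure set (measurableTypeR R) -> \bar R} := mscale (c A) (M setT measurableT).
have m1E B : m1 B = direction_measure setT * M A mA B by rewrite -[in RHS](fineK fT).
have m2E B : m2 B = direction_measure A * M setT measurableT B by rewrite -[in RHS](fineK fA).
have m12 B : measurable B -> m1 B = m2 B.
  apply: (@measure_unique _ R (measurableTypeR R) _ (fun k => `]-oo, k%:R]%classic)
    (@measurable_gen_itvNyc R)).
  - move=> _ _ [x ->] [y ->]; exists (Num.min x y).
    by apply/seteqP; split => z /=; rewrite !in_itv /= le_min => /andP.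
  - by move=> k; exists k%:R.
  - apply/seteqP; split => // z _; exists (Num.trunc `|z|).+1 => //=.
    rewrite in_itv /=; apply: (le_trans (ler_norm z)); apply: ltW; exact: truncnS_gt.
  - move=> _ [x ->]; rewrite m1E m2E !Moo; case: ifP => _; last by rewrite !mule0.
    by rewrite muleCA [RHS]muleCA [direction_measure A * _]muleC.
  - move=> k; rewrite m1E Moo; case: ifP => _; last by rewrite mule0.
    by rewrite -(fineK fT) -(fineK fA) -!EFinM ltry.
have := eq_measure_integral m2 (f := EFin \o phi) (D := setT) (fun B mB _ => m12 B mB).
have mE : measurable_fun setT (EFin \o phi) by exact/measurable_EFinP.
rewrite !ge0_integral_mscale //= ?ME; try by move=> x _; rewrite lee_fin.
by rewrite preimage_setT setIT !fineK.
Qed.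

End polar.

Lemma ceval_normsq (R : realType) d (x : d.-tuple R) :
  ceval (normsq R d) x = (enorm x ^+ 2)%:C%C.
Proof.
rewrite sqr_enorm /ceval !rmorph_sum; apply: eq_bigr => i _.
rewrite rmorphXn /= mpoly.mevalXU; exact: (esym (rmorphXn (@real_complex R) 2 _)).
Qed.

Section sphere_orthogonality.
Variables (R : realType) (d : nat).
Local Notation La := (lebesgue R d).
Local Notation dm := (direction_measure R d).
Local Open Scope ereal_scope.

(** As functions of g both sides are integrals against measures on the directions, and
    [polar_uniqueness] says that these two measures agree. *)
Lemma polar_formula (phi : R -> R) (g : d.-tuple R -> \bar R) :
  measurable_fun setT phi -> (forall r, (0 <= phi r)%R) ->
  measurable_fun setT g -> (forall x, 0 <= g x) ->
  \int[La]_(x in @punctured R d) (phi (enorm x))%:E < +oo ->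
  dm setT * \int[La]_x (g (direction x) * (phi (enorm x) * \1_(@punctured R d) x)%:E) =
  \int[La]_(x in @punctured R d) (phi (enorm x))%:E * \int[dm]_x g x.
Proof.
move=> mphi phi0 mg g0; set c := \int[La]_(x in _) _ => coo.
have mP := @measurable_punctured R d.
pose w x : R := (phi (enorm x) * \1_(@punctured R d) x)%R.
have mphie : measurable_fun setT (phi \o @enorm R d).
  exact: measurableT_comp mphi (@measurable_enorm R d).
have mw : measurable_fun setT w by apply: measurable_funM.
have w0 x : (0 <= w x)%R by rewrite mulr_ge0.
have [nu nuE] := exists_density La mw w0.
have c0 : 0 <= c by apply: integral_ge0 => x _; rewrite lee_fin.
have fc : c \is a fin_num by rewrite ge0_fin_numE.
have fb : dm setT \is a fin_num by rewrite ge0_fin_numE //; exact: direction_measure_fin.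
pose nud : {measure set (d.-tuple R) -> \bar R} :=
  image_measure nu (@measurable_direction R d).
pose m1 : {measure set (d.-tuple R) -> \bar R} :=
  mscale (NngNum (fine_ge0 (measure_ge0 dm setT))) nud.
pose m2 : {measure set (d.-tuple R) -> \bar R} := mscale (NngNum (fine_ge0 c0)) dm.
have m12 A : measurable A -> m1 A = m2 A.
  move=> mA; have mdA := measurable_preimage_direction mA.
  transitivity (dm setT * nu (@direction R d @^-1` A)).
    by rewrite -[in RHS](fineK fb).
  transitivity (c * dm A); last by rewrite -[in LHS](fineK fc).
  rewrite [RHS]muleC -(polar_uniqueness mA mphi phi0); congr (_ * _).
  rewrite -[in LHS](setIT (_ @^-1` _)) -integral_indic // nuE //; last first.
    by apply/measurable_EFinP; exact: measurable_indic.
  rewrite [RHS]integral_mkcond; apply: eq_integral => x _.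
  rewrite patchE -EFinM /w !indicE in_setI mulrCA.
  by case: (_ \in @punctured _ _); case: (_ \in _ @^-1` _); rewrite ?(mulr1, mulr0).
have := eq_measure_integral m2 (f := g) (D := setT) (fun A mA _ => m12 A mA).
rewrite !ge0_integral_mscale //= !fineK // => <-; congr (_ * _).
rewrite ge0_integral_image // nuE //.
exact: measurableT_comp mg (@measurable_direction R d).
Qed.

(** With phi(r) = |r|^s e^(-r^2), homogeneity makes the Gaussian integrand phi(|x|) times the value
    of f at the direction of x. [polar_formula] is for nonnegative functions, so it is applied to
    the positive and negative parts separately, and the common radial factor c is then cancelled. *)
Lemma Rintegral_direction0 (f : cpoly R d) s : (0 < s)%N ->
  f \is mpoly.ishomog1 s mpoly.mdeg -> gauss_functional f = 0%R ->
  Rintegral dm setT (fun x => complex.Re (ceval f x)) = 0%R.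
Proof.
move=> s0 hf Gf.
have [dm0|dm0] := eqVneq (dm setT) 0.
  rewrite /Rintegral (eq_measure_integral mzero) ?integral_measure_zero // => A mA _.
  apply/eqP; rewrite eq_le [X in _ && X](measure_ge0 dm A) andbT.
  by move: (direction_measure_le mA); rewrite dm0.
pose F x := complex.Re (ceval f x).
have mF : measurable_fun setT F by exact: measurable_Re_ceval.
pose phi (r : R) : R := (`|r| ^+ s * gauss_fun r)%R.
have mphi : measurable_fun setT phi.
  apply: measurable_funM; last exact: measurable_gauss_fun.
  by apply: measurable_funX; exact: normr_measurable.
have phi0 r : (0 <= phi r)%R by rewrite mulr_ge0 ?exprn_ge0 ?gauss_fun_ge0.
have mphie : measurable_fun setT (fun x : d.-tuple R => (phi (enorm x))%:E).
  by apply/measurable_EFinP; exact: measurableT_comp mphi (@measurable_enorm R d).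
set P := @punctured R d; have mP := @measurable_punctured R d.
set c := \int[La]_(x in P) (phi (enorm x))%:E.
have c0 : 0 <= c by apply: integral_ge0 => x _; rewrite lee_fin.
have coo : c < +oo.
  (* As |x| <= 1 + |x|^2, this polynomial dominates |x|^s, and its integral against the Gaussian is
     already known to be finite. *)
  pose h : cpoly R d := ((1 + normsq R d) ^+ s)%R.
  have hE x : complex.Re (ceval h x) = ((1 + enorm x ^+ 2) ^+ s)%R.
    rewrite /ceval rmorphXn rmorphD rmorph1 /= -/(ceval _ _) ceval_normsq.
    by rewrite -[1%R]/((1%R : R)%:C%C) -rmorphD -rmorphXn.
  have /integrableP [mh hoo] := integrable_gauss_functional h.
  apply: le_lt_trans hoo; rewrite /c integral_mkcond; apply: ge0_le_integral => //.
  - by move=> x _; rewrite patchE; case: ifP => // _; rewrite lee_fin.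
  - apply: (measurable_restrictT _ mP).1.
    exact: (measurable_funS measurableT (@subsetT _ _) mphie).
  - exact: measurableT_comp.
  move=> x _; rewrite patchE; case: ifP => [_|_]; last exact: abse_ge0.
  rewrite /= hE prod_gauss_enorm normrM !ger0_norm ?gauss_fun_ge0 //; last first.
    by rewrite exprn_ge0 // addr_ge0 // sqr_ge0.
  rewrite lee_fin /phi ler_wpM2r ?gauss_fun_ge0 // ger0_norm ?enorm_ge0 //.
  rewrite lerXn2r ?nnegrE ?enorm_ge0 ?addr_ge0 ?sqr_ge0 //.
  have := enorm_ge0 x; nra.
(* phi(|x|) is positive off the origin, so c = 0 would make [punctured], hence the punctured ball, a
   null set, and the direction measure would vanish. *)
have cn0 : c != 0.
  apply: contra_neq dm0 => c0'.
  have /ae_eq_integral_abs : \int[La]_(x in P) `|(phi (enorm x))%:E| = 0.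
    rewrite -[RHS]c0'; apply: eq_integral => x _.
    by rewrite gee0_abs // lee_fin.
  move=> /(_ mP (measurable_funTS mphie)) ae.
  have P0 : La P = 0.
    apply: (negligibleP La mP).1; apply: negligibleS ae => x /= Px /(_ Px) [].
    apply/eqP; rewrite gt_eqF // mulr_gt0 ?expR_gt0 // exprn_gt0 // normr_gt0 gt_eqF //.
  apply/eqP; rewrite eq_le measure_ge0 andbT -P0.
  rewrite /direction_measure /image_measure /pushforward /= /mrestr preimage_setT setTI.
  apply: le_measure; rewrite ?inE //; first exact: measurable_punctured_ball.
  by move=> x /= /andP [].
(* Here s > 0 matters: a form of positive degree vanishes at the origin, so restricting to
   [punctured] loses nothing. *)
have FP x : ~ P x -> F x = 0%R.
  move=> /negP; rewrite -leNgt => x0.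
  have e0 : enorm x = 0%R by apply/eqP; rewrite eq_le x0 enorm_ge0.
  have -> : x = dilation 0%R x.
    apply: eq_from_tnth => i; rewrite tnth_mktuple mul0r; apply/eqP.
    by rewrite -normr_le0 -e0 ler_tnth_enorm.
  by rewrite /F (ceval_homogeneous _ _ hf) expr0n gtn_eqF // mul0r.
pose W (x : d.-tuple R) : R := (\prod_(i < d) gauss_fun (tnth x i))%R.
have W0 x : (0 <= W x)%R by rewrite prodr_ge0 // => i _; exact: gauss_fun_ge0.
have FW x : P x -> (F x * W x = phi (enorm x) * F (direction x))%R.
  move=> Px; have := ceval_homogeneous (enorm x) (direction x) hf.
  rewrite dilation_direction // => e.
  by rewrite /F e /W prod_gauss_enorm /phi (ger0_norm (enorm_ge0 x)) mulrAC.
(* h will be the map to the positive or to the negative part; its positive homogeneity lets phi(|x|)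
   be pulled out of it. *)
have polar (h : R -> R) : measurable_fun setT h -> (forall y, 0 <= h y)%R ->
    (forall a y, 0 <= a -> h (a * y) = a * h y)%R ->
    dm setT * \int[La]_x (h (F x * W x))%:E = c * \int[dm]_x (h (F x))%:E.
  move=> mh h0 hM.
  have mhF : measurable_fun setT (fun x => (h (F x))%:E).
    by apply/measurable_EFinP; exact: measurableT_comp mh mF.
  rewrite -(polar_formula mphi phi0 mhF) //; last by move=> x; rewrite lee_fin.
  congr (_ * _); apply: eq_integral => x _; rewrite -EFinM; congr EFin.
  rewrite indicE; case: (boolP (x \in P)) => [|/negP]; rewrite inE => Px.
    rewrite mulr1 (FW _ Px) (hM _ (F (direction x)) (phi0 (enorm x))).
    exact: mulrC.
  have h00 : h 0%R = 0%R by rewrite -[LHS](congr1 h (mul0r 0%R)) hM // mul0r.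
  by rewrite FP // mul0r h00 !mulr0.
have mpos (e : R) : measurable_fun setT (fun y : R => Num.max (e * y) 0)%R.
  by apply: measurable_maxr => //; exact: measurable_funM.
have posM (e a y : R) : (0 <= a)%R ->
    (Num.max (e * (a * y)) 0 = a * Num.max (e * y) 0)%R.
  by move=> a0; rewrite maxr_pMr // mulr0 mulrCA.
have pos0 (e y : R) : (0 <= Num.max (e * y) 0)%R by rewrite le_max lexx orbT.
have polarp := polar _ (mpos 1%R) (pos0 1%R) (posM 1%R).
have polarn := polar _ (mpos (-1)%R) (pos0 (-1)%R) (posM (-1)%R).
have intFW := integrable_gauss_functional f.
have pE (m : {measure set (d.-tuple R) -> \bar R}) (G : d.-tuple R -> R) :
    \int[m]_x (EFin \o G)^\+ x = \int[m]_x (Num.max (1 * G x) 0)%:E.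
  by apply: eq_integral => x _; rewrite funeposE mul1r EFin_max.
have nE (m : {measure set (d.-tuple R) -> \bar R}) (G : d.-tuple R -> R) :
    \int[m]_x (EFin \o G)^\- x = \int[m]_x (Num.max (-1 * G x) 0)%:E.
  by apply: eq_integral => x _; rewrite funenegE mulN1r EFin_max.
have pfin := integrable_fin_num measurableT (integrable_funepos measurableT intFW).
have nfin := integrable_fin_num measurableT (integrable_funeneg measurableT intFW).
have pn : \int[La]_x (Num.max (1 * (F x * W x)) 0)%:E =
          \int[La]_x (Num.max (-1 * (F x * W x)) 0)%:E.
  move: Gf; rewrite /gauss_functional /Rintegral integralE.
  rewrite -(pE La (fun x => F x * W x)%R) -(nE La (fun x => F x * W x)%R).
  rewrite -(fineK pfin) -(fineK nfin) -EFinB /= => /eqP.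
  by rewrite subr_eq0 => /eqP ->.
rewrite /Rintegral integralE pE nE.
suff -> : \int[dm]_x (Num.max (1 * F x) 0)%:E = \int[dm]_x (Num.max (-1 * F x) 0)%:E.
  by case: (integral _ _ _) => [r| |] //=; rewrite subrr.
have cinj (u v : \bar R) : c * u = c * v -> u = v.
  have : 0 < c by rewrite lt0e cn0.
  rewrite -(fineK (_ : c \is a fin_num)) ?ge0_fin_numE // lte_fin => k0 e.
  have V : (fine c)^-1%:E * (fine c)%:E = 1 by rewrite -EFinM mulVf // gt_eqF.
  by rewrite -[u]mul1e -[v]mul1e -V -!muleA e.
by apply: cinj; rewrite -polarp -polarn pn.
Qed.

End sphere_orthogonality.

(** * Orthogonality on the sphere *)

Section surface.
Variables (R : realType) (d : nat).
Local Notation S := (surface_measure R d).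
Local Notation dm := (direction_measure R d).
Local Open Scope ereal_scope.

Lemma measurable_sphere : measurable (@sphere R d).
Proof.
rewrite (_ : @sphere R d = @enorm R d @^-1` [set 1%R]) //.
exact: (@measurable_preimage_enorm R d [set 1%R]).
Qed.

Lemma surface_measureE A : S A = (d%:R)%:E * dm A.
Proof. by []. Qed.

(** The direction of a point of the punctured ball already has norm 1. *)
Lemma surface_measure_sphere A : S (A `&` @sphere R d) = S A.
Proof.
rewrite !surface_measureE /direction_measure /image_measure /pushforward /= /mrestr.
congr (_ * lebesgue R d _); apply/seteqP; split => x /=; first by move=> [[]].
move=> [Ax PBx]; split => //; split => //.
by apply: enorm_direction; case/andP: PBx.
Qed.

Lemma ge0_integral_sphere (f : d.-tuple R -> \bar R) :
  measurable_fun setT f -> (forall x, 0 <= f x) ->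
  \int[S]_(x in @sphere R d) f x = \int[S]_x f x.
Proof.
move=> mf f0; rewrite -(ge0_integral_mrestr S measurable_sphere mf f0).
by apply: eq_measure_integral => A mA _; rewrite /= /mrestr surface_measure_sphere.
Qed.

Lemma Rintegral_sphere (f : d.-tuple R -> R) : measurable_fun setT f ->
  Rintegral S (@sphere R d) f = Rintegral S setT f.
Proof.
move=> /measurable_EFinP mf; rewrite /Rintegral integralE [in RHS]integralE.
by rewrite !ge0_integral_sphere //; [exact: measurable_funeneg|exact: measurable_funepos].
Qed.

Lemma Rintegral_surface (f : d.-tuple R -> R) : measurable_fun setT f ->
  Rintegral dm setT f = 0%R -> Rintegral S setT f = 0%R.
Proof.
move=> /measurable_EFinP mf; rewrite /Rintegral integralE [in X in _ -> X]integralE.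
have mp := measurable_funepos mf; have mn := measurable_funeneg mf.
rewrite !(ge0_integral_mscale dm) //.
move: (integral dm _ _) (integral dm _ _) => u v.
have [->|d0] := eqVneq d 0%N; first by rewrite !mul0e subee.
have {}d0 : (0 < d%:R%:E :> \bar R) by rewrite lte_fin ltr0n lt0n.
(* An infinite u or v makes the difference infinite before and after scaling by d > 0, and [fine]
   sends both to 0. *)
case: u v => [u| |] [v| |] //=; rewrite ?gt0_muley ?gt0_muleNy //=.
by move/eqP; rewrite subr_eq0 => /eqP ->; rewrite subrr.
Qed.

Lemma integrable_surface (f : d.-tuple R -> R) (C : R) :
  measurable_fun setT f -> (forall x, sphere x -> `|f x| <= C)%R ->
  S.-integrable setT (EFin \o f).
Proof.
move=> /measurable_EFinP mf fC; apply/integrableP; split => //.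
have ma : measurable_fun setT (abse \o (EFin \o f)) by exact: measurableT_comp.
rewrite -(ge0_integral_sphere ma) => [|x]; last exact: abse_ge0.
apply: (@le_lt_trans _ _ (\int[S]_(x in @sphere R d) (`|C|)%:E)).
  apply: ge0_le_integral => //.
  - exact: measurable_sphere.
  - by move=> x _; exact: abse_ge0.
  - exact: (measurable_funS measurableT (@subsetT _ _) ma).
  - by move=> x Sx; rewrite lee_fin (le_trans (fC x Sx)) // ler_norm.
rewrite integral_cst ?lte_mul_pinfty //; last exact: measurable_sphere.
exact: le_lt_trans (direction_measure_le measurable_sphere) (direction_measure_fin R d).
Qed.

End surface.

Section harmonic_basis.
Variables (R : realType) (d : nat) (a : nat -> nat).
Variable Y : forall k, 'I_(a k) -> cpoly R d.
Hypothesis Y_basis : orthonormal_harmonic_basis Y.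
Local Notation S := (surface_measure R d).

Definition harm k (l : 'I_(a k)) (x : d.-tuple R) : R := complex.Re (ceval (Y l) x).

Lemma measurable_harm k (l : 'I_(a k)) : measurable_fun setT (harm l).
Proof. exact: measurable_Re_ceval. Qed.

Lemma ceval_harm k (l : 'I_(a k)) x : ceval (Y l) x = (harm l x)%:C%C.
Proof.
have [_ _ /(_ k l x) im _] := Y_basis.
by move: im; rewrite /harm; case: (ceval _ _) => u v /= ->.
Qed.

Lemma harm_dilation k (l : 'I_(a k)) r x :
  harm l (dilation r x) = r ^+ k * harm l x.
Proof. by have [/(_ k l) [hY _] _ _ _] := Y_basis; exact: ceval_homogeneous. Qed.

Lemma Re_ceval_sphere_bound (f : cpoly R d) : exists C,
  0 <= C /\ forall x, sphere x -> `|complex.Re (ceval f x)| <= C.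
Proof.
have [C [N [C0 fC]]] := Re_ceval_bound f.
exists (C * 2); split => [|x Sx]; first by rewrite mulr_ge0.
have -> : x = dilation 1 x.
  by apply: eq_from_tnth => i; rewrite tnth_mktuple mul1r.
have := fC 1 x ler01; rewrite expr1n; apply => i.
by rewrite -Sx ler_tnth_enorm.
Qed.

Lemma harm_bound k (l : 'I_(a k)) : exists C,
  0 <= C /\ forall x, sphere x -> `|harm l x| <= C.
Proof. exact: Re_ceval_sphere_bound. Qed.

(** Distinct degrees force k + k' > 0, so the product has the positive degree that
    [Rintegral_direction0] requires. *)
Lemma harm_orthogonal k (l : 'I_(a k)) k' (l' : 'I_(a k')) : k != k' ->
  Rintegral S setT (fun x => harm l x * harm l' x) = 0.
Proof.
move=> kk'; have [hY _ _ _] := Y_basis.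
have E x : harm l x * harm l' x = complex.Re (ceval (Y l * Y l') x).
  by rewrite cevalM ceval_harm ceval_harm -rmorphM.
under eq_Rintegral do rewrite E.
apply: Rintegral_surface; first exact: measurable_Re_ceval.
apply: (@Rintegral_direction0 _ _ _ (k + k')).
- by rewrite addn_gt0; case: k k' kk' {l l' E} => [|k] [|k'].
- by apply: mpoly.dhomogM; [have [] := hY k l|have [] := hY k' l'].
- exact: harmonic_orthogonal_gauss kk'.
Qed.

Lemma harm_orthonormal k (l l' : 'I_(a k)) :
  Rintegral S setT (fun x => harm l x * harm l' x) = (l == l')%:R.
Proof.
have [_ _ _ /(_ k l l') /(congr1 (@complex.Re R))] := Y_basis.
rewrite /cintegral /=.
under eq_Rintegral do rewrite !ceval_harm conjC_real -rmorphM /=.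
rewrite Rintegral_sphere; first by move=> ->; case: eqP.
by apply: measurable_funM; exact: measurable_harm.
Qed.

(** |y| <= (1 + y^2)/2, and the square of a basis element integrates to 1. The bound is uniform in k
    and l, which is what lets the sums of weights control the whole series. *)
Lemma integral_harm_le k (l : 'I_(a k)) :
  (\int[S]_x `|harm l x|%:E <= ((fine (S setT) + 1) / 2)%:E)%E.
Proof.
have [C [C0 hC]] := harm_bound l.
have m := measurable_harm l.
have i1 : S.-integrable setT (EFin \o cst (1 / 2 : R)).
  by apply: (@integrable_surface _ _ _ (1/2)) => // x _; rewrite /= ger0_norm.
have i2 : S.-integrable setT (EFin \o (fun x => 1 / 2 * (harm l x * harm l x))).
  apply: (@integrable_surface _ _ _ (1/2 * (C * C))).
    by apply: measurable_funM => //; apply: measurable_funM.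
  by move=> x /hC yC; rewrite normrM [`|1 / 2|]ger0_norm // ler_wpM2l // normrM ler_pM.
have i3 : S.-integrable setT (EFin \o (fun x => harm l x * harm l x)).
  apply: (@integrable_surface _ _ _ (C * C)); first exact: measurable_funM.
  by move=> x /hC yC; rewrite normrM ler_pM.
have e : Rintegral S setT (fun x => 1 / 2 + 1 / 2 * (harm l x * harm l x)) =
    (fine (S setT) + 1) / 2.
  rewrite (@RintegralD _ _ _ _ _ (cst (1 / 2))) // Rintegral_cst //.
  rewrite RintegralZl // harm_orthonormal eqxx.
  by rewrite mulr1 [RHS]mulrC mulrDr mulr1 mul1r.
have i12 := integrableD measurableT i1 i2.
rewrite -e /Rintegral fineK; last exact: (integrable_fin_num measurableT i12).
apply: ge0_le_integral => //.
- by apply/measurable_EFinP; exact: measurableT_comp.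
- by apply/measurable_EFinP; apply: measurable_funD => //; apply: measurable_funM => //;
    apply: measurable_funM.
move=> x _; rewrite lee_fin -[X in 1 / 2 * X]expr2 -(real_normK (num_real (harm l x))).
by have := sqr_ge0 (`|harm l x| - 1); lra.
Qed.

End harmonic_basis.

(** * The pseudo-positive charge *)

Section harmonic_measure.
Variables (R : realType) (d : nat) (a : nat -> nat).
Variable Y : forall k, 'I_(a k) -> cpoly R d.
Hypothesis Y_basis : orthonormal_harmonic_basis Y.
Local Notation S := (surface_measure R d).
Local Open Scope ereal_scope.

(* (l, (w, r)) stands for the measure w Y_{k,l}(theta) dtheta carried to the
   sphere of radius r. *)
Definition atom k : Type := ('I_(a k) * ({nonneg R} * {nonneg R}))%type.

Variable s : forall k, seq (atom k).
Local Notation weight z := (z.2.1%:num).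
Local Notation radius z := (z.2.2%:num).

Hypothesis s_summable : forall N : nat,
  \sum_(0 <= k <oo) (\sum_(z <- s k) weight z * radius z ^+ N)%R%:E < +oo.

(** p is later the positive or the negative part, so that the signed densities w Y_{k,l} are split
    into two measures. *)
Lemma exists_harm_measure (p : R -> R) :
  measurable_fun setT p -> (forall y, 0 <= p y)%R ->
  exists mu : {measure set (d.-tuple R) -> \bar R}, forall f : d.-tuple R -> \bar R,
    measurable_fun setT f -> (forall x, 0 <= f x) ->
    \int[mu]_x f x = \sum_(0 <= k <oo) \sum_(z <- s k)
      \int[S]_x (f (dilation (radius z) x) * (weight z * p (harm Y z.1 x))%:E).
Proof.
move=> mp p0.
have ex1 k (z : atom k) : exists mu : {measure set (d.-tuple R) -> \bar R},
    forall f : d.-tuple R -> \bar R, measurable_fun setT f -> (forall x, 0 <= f x) ->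
    \int[mu]_x f x =
      \int[S]_x (f (dilation (radius z) x) * (weight z * p (harm Y z.1 x))%:E).
  have mg : measurable_fun setT (fun x => weight z * p (harm Y z.1 x))%R.
    apply: measurable_funM => //; apply: measurableT_comp mp _; exact: measurable_harm.
  have g0 x : (0 <= weight z * p (harm Y z.1 x))%R by rewrite mulr_ge0.
  have [nu nuE] := exists_density S mg g0.
  exists (image_measure nu (@measurable_dilation R d (radius z))) => f mf f0.
  rewrite ge0_integral_image // nuE //.
  exact: measurableT_comp mf (@measurable_dilation R d _).
have ex2 k : exists mu : {measure set (d.-tuple R) -> \bar R},
    forall f : d.-tuple R -> \bar R, measurable_fun setT f -> (forall x, 0 <= f x) ->
    \int[mu]_x f x = \sum_(z <- s k)
      \int[S]_x (f (dilation (radius z) x) * (weight z * p (harm Y z.1 x))%:E).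
  have /choice [m mE] := ex1 k.
  have [nu [_ nuE]] := exists_measure_sum (s k) m.
  by exists nu => f mf f0; rewrite nuE //; apply: eq_bigr => z _; exact: mE.
have /choice [m mE] := ex2.
exists (mseries m 0) => f mf f0; rewrite ge0_integral_measure_series //.
by apply: eq_eseriesr => k _; exact: mE.
Qed.

(** Growth is measured along rays through the sphere, because all the mass sits on spheres of radius
    r. *)
Definition poly_growth (f : d.-tuple R -> R) : Prop :=
  exists C (N : nat), (0 <= C)%R /\ forall r x, (0 <= r)%R -> sphere x ->
    (`|f (dilation r x)| <= C * (1 + r ^+ N))%R.

Let K : R := ((fine (S setT) + 1) / 2)%R.

Let K0 : (0 <= K)%R.
Proof. by rewrite divr_ge0 // addr_ge0 // fine_ge0. Qed.

(** An atom of weight w and radius r contributes at most C (1 + r^N) w K, so summability of w r^0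
    and of w r^N suffices. *)
Lemma harm_series_fin (p : R -> R) (f : d.-tuple R -> R) :
  measurable_fun setT p -> (forall y, 0 <= p y <= `|y|)%R ->
  measurable_fun setT f -> poly_growth f -> (forall x, 0 <= f x)%R ->
  \sum_(0 <= k <oo) \sum_(z <- s k)
    \int[S]_x ((f (dilation (radius z) x))%:E * (weight z * p (harm Y z.1 x))%:E)
  < +oo.
Proof.
move=> mp pb mf [C [N [C0 fC]]] f0.
have p0 y : (0 <= p y)%R by case/andP: (pb y).
have pl y : (p y <= `|y|)%R by case/andP: (pb y).
have mh k (l : 'I_(a k)) := measurable_harm Y l.
pose u k := (\sum_(z <- s k) weight z * radius z ^+ 0)%R.
pose v k := (\sum_(z <- s k) weight z * radius z ^+ N)%R.
have u0 k : (0 <= u k)%R by apply: sumr_ge0 => z _; rewrite mulr_ge0.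
have v0 k : (0 <= v k)%R by apply: sumr_ge0 => z _; rewrite mulr_ge0.
apply: (@le_lt_trans _ _ (\sum_(0 <= k <oo) (C * K)%:E * ((u k)%:E + (v k)%:E))).
  apply: lee_nneseries => [k _ _|k _].
    by apply: sume_ge0 => z _; apply: integral_ge0 => x _; rewrite mule_ge0 ?lee_fin ?mulr_ge0.
  rewrite -EFinD -EFinM /u /v -big_split /= mulr_sumr -sumEFin; apply: lee_sum => z _.
  have mdf : measurable_fun setT (fun x => f (dilation (radius z) x)).
    exact: measurableT_comp mf (@measurable_dilation R d _).
  have mph : measurable_fun setT (fun x => p (harm Y z.1 x)).
    exact: measurableT_comp mp (mh _ _).
  have mi : measurable_fun setT (fun x =>
      (f (dilation (radius z) x))%:E * (weight z * p (harm Y z.1 x))%:E).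
    apply: emeasurable_funM; apply/measurable_EFinP => //.
    exact: measurable_funM.
  have mr : measurable_fun setT (fun x =>
      (C * (1 + radius z ^+ N) * weight z)%:E * `|harm Y z.1 x|%:E).
    apply: emeasurable_funM; apply/measurable_EFinP => //.
    exact: measurableT_comp.
  rewrite -ge0_integral_sphere //; last first.
    by move=> x; rewrite mule_ge0 ?lee_fin ?mulr_ge0.
  apply: (@le_trans _ _ (\int[S]_(x in @sphere R d)
      ((C * (1 + radius z ^+ N) * weight z)%:E * `|harm Y z.1 x|%:E))).
    apply: ge0_le_integral.
    - exact: measurable_sphere.
    - by move=> x _; rewrite mule_ge0 ?lee_fin ?mulr_ge0.
    - exact: (measurable_funS measurableT (@subsetT _ _) mi).
    - exact: (measurable_funS measurableT (@subsetT _ _) mr).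
    - move=> x Sx; rewrite -!EFinM lee_fin mulrA ler_pM ?mulr_ge0 //.
      by rewrite ler_wpM2r // (le_trans _ (fC _ _ _ Sx)) // ler_norm.
  have c0 : (0 <= C * (1 + radius z ^+ N) * weight z)%R.
    by rewrite !mulr_ge0 // addr_ge0.
  rewrite ge0_integral_sphere //; last by move=> x; rewrite mule_ge0.
  rewrite ge0_integralZl //; last first.
    by apply/measurable_EFinP; exact: measurableT_comp.
  apply: (@le_trans _ _ ((C * (1 + radius z ^+ N) * weight z)%:E * K%:E)).
    by apply: lee_wpmul2l => //; exact: integral_harm_le.
  rewrite -EFinM lee_fin le_eqVlt; apply/orP; left; apply/eqP.
  by rewrite expr0; ring.
rewrite nneseriesZl; last by move=> k _; rewrite adde_ge0 ?lee_fin.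
rewrite nneseriesD; try by move=> k _ _; rewrite lee_fin.
rewrite lte_mul_pinfty ?lee_fin ?mulr_ge0 //; exact: (lte_add_pinfty (s_summable 0) (s_summable N)).
Qed.


Lemma integrable_scaled_harm (f : d.-tuple R -> R) k (l : 'I_(a k)) (w r : R) :
  measurable_fun setT f -> poly_growth f -> (0 <= w)%R -> (0 <= r)%R ->
  S.-integrable setT (EFin \o (fun x => f (dilation r x) * (w * harm Y l x))%R).
Proof.
move=> mf [C [N [C0 fC]]] w0 r0; have [D [D0 hD]] := harm_bound Y l.
apply: (@integrable_surface _ _ _ (C * (1 + r ^+ N) * (w * D))).
  apply: measurable_funM.
    exact: measurableT_comp mf (@measurable_dilation R d _).
  by apply: measurable_funM => //; exact: measurable_harm.
move=> x Sx; rewrite !normrM (ger0_norm w0); apply: ler_pM => //.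
- by rewrite mulr_ge0.
- exact: fC.
- by rewrite ler_wpM2l // hD.
Qed.

(** The charge is mu1 - mu2, for the positive and negative parts of the harmonics. Against h(|x|)
    Y_{k,l} the atoms of all other indices drop out by orthogonality, and the factor r^k comes from
    the homogeneity of Y_{k,l}. *)
Theorem exists_harm_charge :
  exists nu : {charge set (d.-tuple R) -> \bar R}, forall f : d.-tuple R -> R,
    measurable_fun setT f -> poly_growth f ->
    (charge_total_variation nu).-integrable setT (EFin \o f) /\
    forall k (l : 'I_(a k)) (h : R -> R),
      (forall x, f x = h (enorm x) * harm Y l x)%R ->
      charge_integral nu f =
      (\sum_(z <- s k | z.1 == l) weight z * h (radius z) * radius z ^+ k)%R.
Proof.
pose pos (e y : R) : R := Num.max (e * y)%R 0%R.
have mpos e : measurable_fun setT (pos e).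
  by apply: measurable_maxr => //; exact: measurable_funM.
have pos0 e y : (0 <= pos e y)%R by rewrite /pos le_max lexx orbT.
have posb e y : (`|e| = 1 -> 0 <= pos e y <= `|y|)%R.
  move=> e1; rewrite pos0 /pos ge_max normr_ge0 andbT.
  by rewrite (le_trans (ler_norm _)) // normrM e1 mul1r.
have n1 : (`|1 : R| = 1)%R by rewrite normr1.
have nN1 : (`|-1 : R| = 1)%R by rewrite normrN normr1.
have [mu1 mu1E] := exists_harm_measure (mpos 1%R) (pos0 1%R).
have [mu2 mu2E] := exists_harm_measure (mpos (-1)%R) (pos0 (-1)%R).
have growth_pos (f : d.-tuple R -> R) e : (`|e| = 1)%R -> poly_growth f -> poly_growth (pos e \o f).
  move=> e1 [C [N [C0 fC]]]; exists C, N; split => // r x r0 Sx.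
  rewrite /= ger0_norm // (le_trans _ (fC r x r0 Sx)) //.
  by have /andP [] := posb e (f (dilation r x)) e1.
have mposf (f : d.-tuple R -> R) e : measurable_fun setT f -> measurable_fun setT (pos e \o f).
  by move=> mf; exact: measurableT_comp (mpos e) mf.
have fin e (f : d.-tuple R -> R) : (`|e| = 1)%R -> measurable_fun setT f ->
    poly_growth f -> (forall x, 0 <= f x)%R ->
    \sum_(0 <= k <oo) \sum_(z <- s k)
      \int[S]_x ((f (dilation (radius z) x))%:E * (weight z * pos e (harm Y z.1 x))%:E) < +oo.
  by move=> e1 mf gf f0; apply: harm_series_fin => // y; exact: posb.
have g1 : poly_growth (cst 1%R).
  exists 1%R, 0%N; split => // r x _ _; rewrite /= normr1 expr0 mul1r.
  by rewrite lerDl.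
have fin1 : mu1 setT < +oo.
  rewrite -(setIT setT) -integral_indic // mu1E //; last first.
    by apply/measurable_EFinP; exact: measurable_indic.
  have := fin 1%R (cst 1%R) n1 (measurable_cst _) g1 (fun _ => ler01).
  congr (_ < _); apply: eq_eseriesr => k _; apply: eq_bigr => z _.
  by apply: eq_integral => x _; rewrite indicE in_setT.
have fin2 : mu2 setT < +oo.
  rewrite -(setIT setT) -integral_indic // mu2E //; last first.
    by apply/measurable_EFinP; exact: measurable_indic.
  have := fin (-1)%R (cst 1%R) nN1 (measurable_cst _) g1 (fun _ => ler01).
  congr (_ < _); apply: eq_eseriesr => k _; apply: eq_bigr => z _.
  by apply: eq_integral => x _; rewrite indicE in_setT.
have [nu nuE] := exists_charge_diff fin1 fin2.
exists nu => f mf gf.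
have posE (m : {measure set (d.-tuple R) -> \bar R}) :
    \int[m]_x (EFin \o f)^\+ x = \int[m]_x (pos 1%R (f x))%:E.
  by apply: eq_integral => x _; rewrite funeposE /pos mul1r EFin_max.
have negE (m : {measure set (d.-tuple R) -> \bar R}) :
    \int[m]_x (EFin \o f)^\- x = \int[m]_x (pos (-1)%R (f x))%:E.
  by apply: eq_integral => x _; rewrite funenegE /pos mulN1r EFin_max.
(* e1 selects the positive or negative part of f, and e2 that of the harmonic, hence mu1 or mu2. *)
pose I e1 e2 k := \sum_(z <- s k) \int[S]_x ((pos e1 (f (dilation (radius z) x)))%:E *
   (weight z * pos e2 (harm Y z.1 x))%:E).
have I0 e1 e2 k : 0 <= I e1 e2 k.
  apply: sume_ge0 => z _; apply: integral_ge0 => x _.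
  by rewrite mule_ge0 ?lee_fin ?mulr_ge0.
have Ifin e1 e2 : (`|e1| = 1)%R -> (`|e2| = 1)%R -> \sum_(0 <= k <oo) I e1 e2 k < +oo.
  move=> h1 h2; apply: (fin e2 (pos e1 \o f) h2 (mposf _ _ mf) (growth_pos _ _ h1 gf)).
  by move=> x; exact: pos0.
have intE1 e : \int[mu1]_x (pos e (f x))%:E = \sum_(0 <= k <oo) I e 1%R k.
  apply: mu1E => [|x]; last by rewrite lee_fin.
  by apply/measurable_EFinP; exact: (mposf f).
have intE2 e : \int[mu2]_x (pos e (f x))%:E = \sum_(0 <= k <oo) I e (-1)%R k.
  apply: mu2E => [|x]; last by rewrite lee_fin.
  by apply/measurable_EFinP; exact: (mposf f).
have absE (m : {measure set (d.-tuple R) -> \bar R}) :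
    \int[m]_x `|(f x)%:E| = \int[m]_x (pos 1%R (f x))%:E + \int[m]_x (pos (-1)%R (f x))%:E.
  have mfp e : measurable_fun setT (fun x => (pos e (f x))%:E).
    by apply/measurable_EFinP; exact: (mposf f).
  rewrite -ge0_integralD //; try by move=> x _; rewrite lee_fin.
  apply: eq_integral => x _; rewrite -EFinD /pos mul1r mulN1r abse_EFin; congr EFin.
  exact: (esym (congr1 (@^~ x) (funrposDneg f))).
have mfE : measurable_fun setT (EFin \o f) by exact/measurable_EFinP.
have f1 : mu1.-integrable setT (EFin \o f).
  by apply/integrableP; split => //=; rewrite absE !intE1 lte_add_pinfty // Ifin.
have f2 : mu2.-integrable setT (EFin \o f).
  by apply/integrableP; split => //=; rewrite absE !intE2 lte_add_pinfty // Ifin.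
have [itv nuf] := nuE f f1 f2.
split => // k0 l0 h fE.
pose G k (z : atom k) x : R := (f (dilation (radius z) x) * (weight z * harm Y z.1 x))%R.
have iG k (z : atom k) : S.-integrable setT (EFin \o G k z).
  exact: integrable_scaled_harm.
pose v k (z : atom k) : R := Rintegral S setT (G k z).
have mG k (z : atom k) : measurable_fun setT (G k z).
  by apply/measurable_EFinP; exact: measurable_int (iG k z).
have mterm e1 e2 k (z : atom k) : measurable_fun setT (fun x =>
    (pos e1 (f (dilation (radius z) x)))%:E * (weight z * pos e2 (harm Y z.1 x))%:E).
  apply: emeasurable_funM; apply/measurable_EFinP.
    apply: measurableT_comp (mpos e1) _.
    exact: measurableT_comp mf (@measurable_dilation R d _).
  apply: measurable_funM => //; apply: measurableT_comp (mpos e2) _.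
  exact: measurable_harm.
have term0 e1 e2 k (z : atom k) x :
    0 <= (pos e1 (f (dilation (radius z) x)))%:E * (weight z * pos e2 (harm Y z.1 x))%:E.
  by rewrite mule_ge0 ?lee_fin ?mulr_ge0.
(* The positive part of b (w c) collects the products of parts of equal sign, its negative part
   those of opposite sign. *)
have posM (w b c : R) : (0 <= w)%R ->
    (pos 1 b * (w * pos 1 c) + pos (-1) b * (w * pos (-1) c) = pos 1 (b * (w * c)))%R /\
    (pos (-1) b * (w * pos 1 c) + pos 1 b * (w * pos (-1) c) = pos (-1) (b * (w * c)))%R.
  rewrite /pos !mul1r !mulN1r => w0.
  have max0 (t : R) : (0 <= t)%R -> (Num.max t 0 = t)%R /\ (Num.max (- t) 0 = 0)%R.
    by move=> t0; rewrite max_l // max_r // oppr_le0.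
  have max0' (t : R) : (t <= 0)%R -> (Num.max t 0 = 0)%R /\ (Num.max (- t) 0 = - t)%R.
    by move=> t0; rewrite max_r // max_l // oppr_ge0.
  have /orP [b0|b0] := le_total 0%R b; have /orP [c0|c0] := le_total 0%R c.
  - have [-> ->] := max0 b b0; have [-> ->] := max0 c c0.
    have [-> ->] := max0 (b * (w * c))%R (mulr_ge0 b0 (mulr_ge0 w0 c0)).
    by split; ring.
  - have [-> ->] := max0 b b0; have [-> ->] := max0' c c0.
    have [|-> ->] := max0' (b * (w * c))%R; first by rewrite mulr_ge0_le0 // mulr_ge0_le0.
    by split; ring.
  - have [-> ->] := max0' b b0; have [-> ->] := max0 c c0.
    have [|-> ->] := max0' (b * (w * c))%R; first by rewrite mulr_le0_ge0 // mulr_ge0.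
    by split; ring.
  - have [-> ->] := max0' b b0; have [-> ->] := max0' c c0.
    have [|-> ->] := max0 (b * (w * c))%R; first by rewrite mulr_le0 // mulr_ge0_le0.
    by split; ring.
pose J k (z : atom k) e1 e2 := \int[S]_x
  ((pos e1 (f (dilation (radius z) x)))%:E * (weight z * pos e2 (harm Y z.1 x))%:E).
(* Written additively to avoid differences of extended reals; v is the signed integral over one
   atom. *)
have GE k (z : atom k) :
    J k z 1%R 1%R + J k z (-1)%R (-1)%R =
    (J k z (-1)%R 1%R + J k z 1%R (-1)%R) + (v k z)%:E.
  rewrite /J -!ge0_integralD //.
  have e1 : \int[S]_x (EFin \o G k z)^\+ x \is a fin_num.
    exact: (integrable_fin_num measurableT (integrable_funepos measurableT (iG k z))).
  have e2 : \int[S]_x (EFin \o G k z)^\- x \is a fin_num.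
    exact: (integrable_fin_num measurableT (integrable_funeneg measurableT (iG k z))).
  transitivity (\int[S]_x (EFin \o G k z)^\+ x).
    apply: eq_integral => x _; rewrite -!EFinM -EFinD (posM _ _ _ _).1 //.
    by rewrite funeposE /pos mul1r EFin_max.
  rewrite [X in _ = X + _](_ : _ = \int[S]_x (EFin \o G k z)^\- x); last first.
    apply: eq_integral => x _; rewrite -!EFinM -EFinD (posM _ _ _ _).2 //.
    by rewrite funenegE /pos mulN1r EFin_max.
  rewrite /v /Rintegral integralE -(fineK e1) -(fineK e2) -EFinB /= -EFinD.
  by congr EFin; rewrite addrC subrK.
pose V k : R := (\sum_(z <- s k) v k z)%R.
have AB k : I 1%R 1%R k + I (-1)%R (-1)%R k = (I (-1)%R 1%R k + I 1%R (-1)%R k) + (V k)%:E.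
  rewrite /I /V -!big_split -sumEFin -big_split /=.
  by apply: eq_bigr => z _; exact: GE.
(* On the unit sphere f(r x) = h(r) r^k0 Y_{k0,l0}(x), which leaves the inner product of two
   harmonics. *)
have vE k (z : atom k) : v k z = (weight z * h (radius z) * radius z ^+ k0 *
    Rintegral S setT (fun x => harm Y l0 x * harm Y z.1 x))%R.
  have mhh : measurable_fun setT (fun x => harm Y l0 x * harm Y z.1 x)%R.
    by apply: measurable_funM; exact: measurable_harm.
  have ihh : S.-integrable (@sphere R d) (EFin \o (fun x => harm Y l0 x * harm Y z.1 x)%R).
    have [C [C0 hC]] := harm_bound Y l0; have [D [D0 hD]] := harm_bound Y z.1.
    apply: (integrableS measurableT) => //; first exact: measurable_sphere.
    apply: (@integrable_surface _ _ _ (C * D)) => // x Sx.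
    by rewrite normrM ler_pM // ?hC ?hD.
  rewrite /v -(Rintegral_sphere (mG k z)) -(Rintegral_sphere mhh) -RintegralZl //;
    last exact: measurable_sphere.
  apply: eq_Rintegral => x; rewrite inE => Sx.
  rewrite /G fE (harm_dilation Y_basis) enorm_dilation //.
  by rewrite (Sx : enorm x = 1%R) mulr1; ring.
have V0 k : k != k0 -> V k = 0%R.
  move=> kk; rewrite /V big1 // => z _; rewrite vE harm_orthogonal ?mulr0 // eq_sym //.
have Vk0 : V k0 = (\sum_(z <- s k0 | z.1 == l0) weight z * h (radius z) * radius z ^+ k0)%R.
  rewrite /V [RHS]big_mkcond; apply: eq_bigr => z _; rewrite vE harm_orthonormal // eq_sym.
  by case: eqP => _; rewrite ?mulr1 ?mulr0.
(* Only index k0 carries a nonzero V. Once its terms are taken out, the remaining nonnegative series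
   agree term by term. *)
have XZ : \sum_(0 <= k <oo) I 1%R 1%R k + \sum_(0 <= k <oo) I (-1)%R (-1)%R k =
    (\sum_(0 <= k <oo) I (-1)%R 1%R k + \sum_(0 <= k <oo) I 1%R (-1)%R k) + (V k0)%:E.
  rewrite -!nneseriesD //.
  rewrite (@nneseriesD1 _ _ k0) //; last by move=> k _; exact: adde_ge0.
  rewrite [X in _ = X + _](@nneseriesD1 _ _ k0) //; last by move=> k _; exact: adde_ge0.
  rewrite AB [RHS]addeAC; congr (_ + _).
  by apply: eq_eseriesr => k kk; rewrite AB V0 ?adde0.
rewrite nuf /Rintegral integralE [X in (_ - fine X)%R]integralE !posE !negE !intE1 !intE2 -Vk0.
have Ireal e1 e2 : (`|e1| = 1)%R -> (`|e2| = 1)%R ->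
    exists x : R, \sum_(0 <= k <oo) I e1 e2 k = x%:E.
  move=> h1 h2; exists (fine (\sum_(0 <= k <oo) I e1 e2 k)).
  by rewrite fineK // ge0_fin_numE ?Ifin //; exact: nneseries_ge0.
move: XZ; have [b1 ->] := Ireal _ _ n1 n1; have [b2 ->] := Ireal _ _ nN1 nN1.
have [b3 ->] := Ireal _ _ nN1 n1; have [b4 ->] := Ireal _ _ n1 nN1.
by move: (V k0) => b5; rewrite -!EFinD => -[e] /=; lra.
Qed.

End harmonic_measure.

(** * Expansions in solid harmonics *)

Section expansions.
Variables (R : realType) (d : nat) (a : nat -> nat).
Variable Y : forall k, 'I_(a k) -> cpoly R d.
Implicit Types (f g : cpoly R d) (p q : {poly R[i]}).

Lemma radial_linear : linear (@radial R d).
Proof.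
move=> c p q; rewrite /radial rmorphD /= (map_polyZ (@mpoly.mpolyC d R[i])).
by rewrite hornerD hornerZ mpoly.mul_mpolyC.
Qed.

Lemma radialZD c p q : @radial R d (c *: p + q) = c *: radial d p + radial d q.
Proof. exact: radial_linear. Qed.

Lemma radial0 : @radial R d 0 = 0.
Proof. by rewrite /radial rmorph0 horner0. Qed.

Lemma ceval_radial p x : ceval (radial d p) x = p.[((enorm x) ^+ 2)%:C%C].
Proof.
rewrite -ceval_normsq /ceval /radial.
rewrite -(horner_map (mpoly.meval (fun i => Complex (tnth x i) 0))) /= -map_poly_comp.
by rewrite map_poly_id // => c _; exact: mpoly.mevalC.
Qed.

(** [U] leaves p k l arbitrary beyond the cut-off; setting it to 0 there lets two expansions be
    brought to a common cut-off. *)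
Lemma U_restrict m f : U Y m f -> exists K (p : forall k, 'I_(a k) -> {poly R[i]}),
  [/\ (forall k (l : 'I_(a k)), (size (p k l) <= m.+1)%N),
      forall k (l : 'I_(a k)), (K <= k)%N -> p k l = 0 &
      f = \sum_(k < K) \sum_(l < a k) radial d (p k l) * Y l].
Proof.
move=> [K [p [sp ->]]].
exists K, (fun k l => if (k < K)%N then p k l else 0); split.
- by move=> k l; case: ifP => _; rewrite ?sp // size_poly0.
- by move=> k l; rewrite ltnNge => ->.
- by apply: eq_bigr => k _; apply: eq_bigr => l _; rewrite ltn_ord.
Qed.

Lemma U_widen f K K' (p : forall k, 'I_(a k) -> {poly R[i]}) :
  (forall k (l : 'I_(a k)), (K <= k)%N -> p k l = 0) -> (K <= K')%N ->
  f = \sum_(k < K) \sum_(l < a k) radial d (p k l) * Y l ->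
  f = \sum_(k < K') \sum_(l < a k) radial d (p k l) * Y l.
Proof.
move=> p0 KK ->; rewrite -(big_mkord xpredT (fun k => \sum_(l < a k) radial d (p k l) * Y l)).
rewrite -[RHS](big_mkord xpredT (fun k => \sum_(l < a k) radial d (p k l) * Y l)).
rewrite [RHS](big_cat_nat (n := K)) //=.
rewrite [X in _ = _ + X]big_nat_cond [X in _ = _ + X]big1 ?addr0 //.
move=> k /andP [/andP [Kk _] _].
by rewrite big1 // => l _; rewrite p0 // radial0 mul0r.
Qed.

Lemma U_linear m c f g : U Y m f -> U Y m g -> U Y m (c *: f + g).
Proof.
move=> /U_restrict [K [p [sp p0 ef]]] /U_restrict [K' [q [sq q0 eg]]].
rewrite (U_widen p0 (leq_maxl K K') ef) (U_widen q0 (leq_maxr K K') eg).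
exists (maxn K K'), (fun k l => c *: p k l + q k l); split=> [k l|].
  rewrite (leq_trans (size_polyD _ _)) // geq_max sq andbT.
  by rewrite (leq_trans (size_scale_leq _ _)).
rewrite scaler_sumr -big_split; apply: eq_bigr => k _ /=.
rewrite scaler_sumr -big_split; apply: eq_bigr => l _ /=.
by rewrite radialZD mulrDl scalerAl.
Qed.

Lemma U0 m : U Y m 0.
Proof.
by exists 0%N, (fun _ _ => 0); split => [k l|]; rewrite ?size_poly0 // big_ord0.
Qed.

Lemma U_term m k (l : 'I_(a k)) p : (size p <= m.+1)%N -> U Y m (radial d p * Y l).
Proof.
(* l and l' have different types when k and k' differ, so index pairs are compared as elements of a
   tagged sum. *)
move=> sp; pose tag (k : nat) (l : 'I_(a k)) : {k : nat & 'I_(a k)} := Tagged _ l.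
exists k.+1, (fun k' l' => if tag k' l' == tag k l then p else 0); split => [k' l'|].
  by case: ifP; rewrite ?size_poly0.
rewrite (bigD1 ord_max) //= (bigD1 l) //= eqxx !big1 ?addr0 //.
  move=> k' /negP kk; rewrite big1 // => l' _.
  rewrite ifF ?radial0 ?mul0r //; apply/negP => /eqP e; apply: kk; apply/eqP/val_inj => /=.
  exact: (congr1 (@projT1 _ _) e).
move=> l' /negP ll; rewrite ifF ?radial0 ?mul0r //; apply/negP => /eqP e; apply: ll.
by move: e => /eqP; rewrite eq_Tagged.
Qed.

Section linear.
Variables (m : nat) (T : cpoly R d -> R[i]).
Hypothesis T_linear : linear_on (U Y m) T.

Lemma linear_on0 : T 0 = 0.
Proof.
have := T_linear 1 (U0 m) (U0 m); rewrite scale1r addr0 mul1r => e.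
by apply: (addrI (T 0)); rewrite -e addr0.
Qed.

(** T is linear only on [U], so membership of the partial sums is proved together with the
    formula. *)
Lemma linear_on_sum (I : Type) (s : seq I) (F : I -> cpoly R d) :
  (forall i, U Y m (F i)) ->
  U Y m (\sum_(i <- s) F i) /\ T (\sum_(i <- s) F i) = \sum_(i <- s) T (F i).
Proof.
move=> UF; elim: s => [|i s [US TS]].
  by rewrite !big_nil linear_on0; split => //; exact: U0.
rewrite !big_cons -[F i]scale1r; split; first exact: U_linear.
by rewrite T_linear // TS scale1r mul1r.
Qed.

Lemma component_linear k (l : 'I_(a k)) c p q :
  (size p <= m.+1)%N -> (size q <= m.+1)%N ->
  component Y T l (c *: p + q) = c * component Y T l p + component Y T l q.
Proof.
move=> sp sq; rewrite /component radialZD mulrDl -scalerAl.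
by rewrite T_linear //; exact: U_term.
Qed.

End linear.
End expansions.

(** * The quadrature measures *)

Section gauss_jacobi_nodes.
Variable R : realType.
Implicit Types (p q : {poly R[i]}).

(* Extends a functional that is only known to be linear up to degree N - 1. *)
Definition truncate_functional (N : nat) (L : {poly R[i]} -> R[i]) p : R[i] :=
  \sum_(i < N) p`_i * L 'X^i.

Lemma truncate_functional_linear N L : scalar (truncate_functional N L).
Proof.
move=> c p q; rewrite /truncate_functional mulr_sumr -big_split; apply: eq_bigr => i _ /=.
by rewrite coefD coefZ mulrDl mulrA.
Qed.

HB.instance Definition _ N L := GRing.isLinear.Build R[i] {poly R[i]} R[i] _
  (truncate_functional N L) (truncate_functional_linear N L).

Lemma truncate_functionalE N (L : {poly R[i]} -> R[i]) p :
  (forall c (q r : {poly R[i]}), (size q <= N)%N -> (size r <= N)%N ->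
    L (c *: q + r) = c * L q + L r) ->
  (size p <= N)%N -> truncate_functional N L p = L p.
Proof.
move=> Llin sp.
have s0 : (size (0%R : {poly R[i]}) <= N)%N by rewrite size_poly0.
have L0 : L 0 = 0.
  have := Llin 1 0 0 s0 s0; rewrite scale1r addr0 mul1r => e.
  by apply: (addrI (L 0)); rewrite -e addr0.
have H (s : seq 'I_N) : (size (\sum_(i <- s) p`_i *: 'X^i)%R <= N)%N /\
    L (\sum_(i <- s) p`_i *: 'X^i) = \sum_(i <- s) p`_i * L 'X^i.
  elim: s => [|i s [ss Ls]]; first by rewrite !big_nil.
  have si : (size ('X^i : {poly R[i]})%R <= N)%N by rewrite size_polyXn.
  rewrite !big_cons Llin // Ls; split => //.
  by rewrite (leq_trans (size_polyD _ _)) // geq_max ss (leq_trans (size_scale_leq _ _)).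
rewrite /truncate_functional -(H _).2; congr L.
rewrite -poly_def; apply/polyP => i; rewrite coef_poly.
by case: ltnP => // Ni; rewrite nth_default // (leq_trans sp).
Qed.

Lemma Re_horner_real p (t : R) :
  complex.Re p.[t%:C%C] = \sum_(i < size p) complex.Re p`_i * t ^+ i.
Proof.
rewrite horner_coef raddf_sum; apply: eq_bigr => i _.
by rewrite -rmorphXn /= Re_mul_real.
Qed.

(** Through this, statements about imaginary parts become statements about the real part of -i times
    a polynomial. *)
Lemma Im_Re (z : R[i]) : complex.Im z = complex.Re (Complex 0 (-1) * z).
Proof. by case: z => u v /=; rewrite mul0r mulN1r sub0r opprK. Qed.

Lemma measurable_Re_horner p : measurable_fun setT (fun t : R => complex.Re p.[t%:C%C]).
Proof.
under eq_fun do rewrite Re_horner_real.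
by apply: measurable_sum => i; apply: measurable_funM.
Qed.

Lemma Im_horner p (z : R[i]) :
  complex.Im p.[z] = complex.Re ((Complex 0 (-1) *: p).[z]).
Proof. by rewrite hornerZ Im_Re. Qed.

Lemma cintegral_atomic (I : finType) (sigma : {measure set R -> \bar R})
    (t c : I -> R) p : (forall i, 0 <= c i) ->
  (forall A, measurable A -> sigma A = (\sum_i (c i)%:E * \d_(t i) A)%E) ->
  cintegral sigma setT (fun t => p.[Complex t 0]) =
  \sum_i (c i)%:C%C * p.[(t i)%:C%C].
Proof.
move=> c0 sigmaE; rewrite /cintegral.
rewrite (Rintegral_atomic c0 sigmaE (measurable_Re_horner p)).
under [X in Complex _ X]eq_Rintegral do rewrite Im_horner.
rewrite (Rintegral_atomic c0 sigmaE (measurable_Re_horner _)).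
apply/eqP; rewrite eq_complex !raddf_sum /=; apply/andP; split; apply/eqP.
  by apply: eq_bigr => i _; case: (p.[_]) => u v /=; rewrite mul0r subr0.
apply: eq_bigr => i _; rewrite -Im_horner.
by case: (p.[_]) => u v /=; rewrite mul0r addr0.
Qed.

(** In the degenerate case [exact_extend] raises the exactness from degree 2m - 1 to 2n - 1;
    otherwise m = n and [gauss_jacobi] already gives it. *)
Lemma gauss_jacobi_nodes n (L : {poly R[i]} -> R[i])
    (sigma : {measure set R -> \bar R}) : (0 < n)%N ->
  (forall c p q, (size p <= (2 * n).+1)%N -> (size q <= (2 * n).+1)%N ->
    L (c *: p + q) = c * L p + L q) ->
  positive_functional n L -> gauss_jacobi n L sigma ->
  exists m (t alpha : 'I_m -> R),
    [/\ forall i, 0 <= t i, forall i, 0 < alpha i,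
        forall A, measurable A -> sigma A = (\sum_(i < m) (alpha i)%:E * \d_(t i) A)%E &
        forall p, (size p <= 2 * n)%N ->
          L p = \sum_(i < m) (alpha i)%:C%C * p.[(t i)%:C%C]].
Proof.
move=> n0 Llin [Lp1 Lp2] [m [t [alpha [qo tlt a0 sE ex]]]].
exists m, t, alpha.
have mn : (m <= n)%N by case: qo => [[]//|[-> _]].
(* 2n + 1 coefficients cover degree 2n, the highest degree of p^* p for p of degree n. *)
pose Lt := truncate_functional (2 * n).+1 L.
have LtE p : (size p <= (2 * n).+1)%N -> Lt p = L p.
  exact: (truncate_functionalE Llin).
have a0' i : 0 <= alpha i by exact: ltW.
have exL p : (size p <= 2 * m)%N -> Lt p = \sum_(i < m) (alpha i)%:C%C * p.[(t i)%:C%C].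
  move=> sp; rewrite LtE; last by lia.
  by rewrite ex // (cintegral_atomic p a0' sE).
have size_sqr p k : (size p <= k.+1)%N -> (size (conj_poly p * p)%R <= k.*2.+1)%N.
  move=> sp; rewrite (leq_trans (size_polyMleq _ _)) // size_conj_poly.
  by move: (size p) sp; lia.
have Lpos : positive_functional n Lt.
  split => p sp; rewrite LtE.
  - exact: Lp1.
  - by have := size_sqr _ _ sp; lia.
  - exact: Lp2.
  - rewrite mulrC (leq_trans (size_polyMleq _ _)) // size_polyX addn2 /=.
    by apply: leq_trans (_ : (n.-1).*2.+2 <= _)%N; [rewrite ltnS size_sqr|lia].
have tinj : injective t.
  move=> i j e; apply/eqP; rewrite -val_eqE /=; apply/negPn/negP; rewrite neq_ltn.
  by case/orP => /tlt; rewrite e ltxx.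
split => //.
  exact: (@nodes_ge0 _ n m Lt t alpha tinj a0 mn Lpos n0 exL).
move=> p sp; rewrite -LtE; last exact: leqW.
case: qo => [[_ [q [sq Lq]] _]|[mE _]]; last by apply: exL; rewrite mE.
apply: (@exact_extend _ n m Lt t alpha tinj a0 mn Lpos n0 exL q sq _ p sp).
rewrite -[LHS]/(Lt _) LtE //; have := size_sqr q m; rewrite sq => /(_ (leqnn _)); lia.
Qed.

End gauss_jacobi_nodes.

Section radius_weights.
Variable R : realType.
Local Open Scope ereal_scope.

(** The point 0, where the extended inverse may be +oo, is split off; on ]0, +oo[ the inverse is a
    real power. *)
Lemma measurable_radius_weight N k :
  measurable_fun (`[0%R, +oo[%classic : set R) (fun r : R => (r ^+ N)%:E * ((r ^+ k)%:E)^-1).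
Proof.
have -> : `[0%R, +oo[%classic = [set 0%R] `|` `]0%R, +oo[%classic :> set R.
  by rewrite setU1itv.
apply/measurable_funU => //; split; first exact: measurable_fun_set1.
apply: (eq_measurable_fun (fun r : R => (r ^+ N * (r ^+ k) `^ (-1))%:E)).
  move=> r; rewrite inE /= in_itv /= andbT => r0.
  by rewrite inver gt_eqF ?exprn_gt0 // -EFinM powR_inv1 // exprn_ge0 // ltW.
apply: measurable_funTS; apply/measurable_EFinP; apply: measurable_funM => //.
by apply: (measurableT_comp (measurable_powR _)).
Qed.

Lemma integral_radius_atomic (I : finType) (sigma : {measure set R -> \bar R})
    (t c : I -> R) (f : R -> \bar R) : (forall i, (0 <= c i)%R) ->
  (forall A, measurable A -> sigma A = \sum_i (c i)%:E * \d_(t i) A) ->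
  measurable_fun (`[0%R, +oo[%classic : set R) f -> (forall r, (0 <= r)%R -> 0 <= f r) ->
  \int[radius_measure sigma]_(r in `[0%R, +oo[) f r =
  \sum_i (c i)%:E * f (Num.sqrt (t i)).
Proof.
move=> c0 sE mf f0; rewrite integral_mkcond.
rewrite (ge0_integral_atomic (t := fun i => Num.sqrt (t i)) c0).
- apply: eq_bigr => i _; rewrite patchE ifT // inE /= in_itv /= andbT.
  exact: sqrtr_ge0.
- move=> A mA; rewrite -[LHS]/(sigma (@Num.sqrt R @^-1` A)) sE //.
  by rewrite -[X in measurable X]setTI; exact: (@measurable_sqrt R).
- exact: (measurable_restrictT f (measurable_itv _)).1.
- by move=> r; rewrite patchE; case: ifPn => //; rewrite inE /= in_itv /= andbT => /f0.
Qed.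

End radius_weights.

Section atoms.
Variables (R : realType) (a : nat -> nat).
Variable sigma : forall k, 'I_(a k) -> {measure set R -> \bar R}.
Variable m : forall k, 'I_(a k) -> nat.
Variables t alpha : forall k (l : 'I_(a k)), 'I_(m l) -> R.
Arguments t {k} l _.
Arguments alpha {k} l _.
Hypothesis t_ge0 : forall k (l : 'I_(a k)) i, 0 <= t l i.
Hypothesis alpha_gt0 : forall k (l : 'I_(a k)) i, 0 < alpha l i.
Arguments alpha_gt0 {k} l _.
Hypothesis sigmaE : forall k (l : 'I_(a k)) A, measurable A ->
  sigma l A = (\sum_(i < m l) (alpha l i)%:E * \d_(t l i) A)%E.
Hypothesis C_fin : forall N, (C_ sigma N < +oo)%E.

Lemma C_atomic N : C_ sigma N = (\sum_(0 <= k <oo) \sum_(l < a k) \sum_(i < m l)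
  (alpha l i)%:E * ((Num.sqrt (t l i) ^+ N)%:E * ((Num.sqrt (t l i) ^+ k)%:E)^-1))%E.
Proof.
apply: eq_eseriesr => k _; apply: eq_bigr => l _.
apply: (integral_radius_atomic (c := @alpha k l) _ (sigmaE _)).
- by move=> i; exact: ltW.
- exact: measurable_radius_weight.
- by move=> r r0; rewrite mule_ge0 ?inve_ge0 ?lee_fin ?exprn_ge0.
Qed.

Lemma radius_neq0 k (l : 'I_(a k)) i : Num.sqrt (t l i) ^+ k != 0.
Proof.
apply/negP => /eqP e.
have := C_fin 0; rewrite C_atomic.
have ge0 j (l' : 'I_(a j)) i' : (0 <= (alpha l' i')%:E *
    ((Num.sqrt (t l' i') ^+ 0)%:E * ((Num.sqrt (t l' i') ^+ j)%:E)^-1))%E.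
  by rewrite !mule_ge0 ?inve_ge0 ?lee_fin ?exprn_ge0 // ltW.
(* Isolate the term (k, l, i) of C_0: it is a positive weight times the inverse of 0, that is
   +oo. *)
rewrite (@nneseriesD1 _ _ k) //; last first.
  by move=> j _; apply: sume_ge0 => l' _; apply: sume_ge0.
rewrite (bigD1 l) //= (bigD1 i) //= e inve0 mul1e gt0_muley ?lte_fin //.
have yD (x : \bar R) : (0 <= x -> +oo + x = +oo)%E.
  by move=> x0; rewrite addye // gt_eqF // (lt_le_trans ltNy0 x0).
rewrite !yD ?ltxx //.
- by apply: nneseries_ge0 => j *; do 2 apply: sume_ge0 => *; exact: ge0.
- by do 2 apply: sume_ge0 => *; exact: ge0.
- by apply: sume_ge0 => *; exact: ge0.
Qed.

Arguments radius_neq0 {k} l _.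

(** The weight is divided by r^k to compensate for the r^k that homogeneity of Y_{k,l} produces; the
    sums of weight times r^N are then the C_N. *)
Definition atoms k : seq (atom R a k) :=
  [seq (l, (NngNum (divr_ge0 (ltW (alpha_gt0 l i)) (exprn_ge0 k (sqrtr_ge0 (t l i)))),
            NngNum (sqrtr_ge0 (t l i)))) |
    l <- enum 'I_(a k), i <- enum 'I_(m l)].

Lemma sum_atoms k (F : 'I_(a k) -> R -> R -> R) :
  \sum_(z <- atoms k) F z.1 z.2.1%:num z.2.2%:num =
  \sum_(l < a k) \sum_(i < m l)
    F l (alpha l i / Num.sqrt (t l i) ^+ k) (Num.sqrt (t l i)).
Proof.
rewrite /atoms big_allpairs_dep big_enum /=; apply: eq_bigr => l _.
by rewrite big_enum.
Qed.

Lemma atoms_summable N :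
  (\sum_(0 <= k <oo) (\sum_(z <- atoms k) z.2.1%:num * z.2.2%:num ^+ N)%R%:E < +oo)%E.
Proof.
have := C_fin N; rewrite C_atomic; congr (_ < _)%E; apply: eq_eseriesr => k _.
rewrite (sum_atoms (fun _ w r => w * r ^+ N)) -sumEFin; apply: eq_bigr => l _.
rewrite -sumEFin; apply: eq_bigr => i _.
rewrite inver (negbTE (radius_neq0 l i)) -!EFinM; congr EFin.
by rewrite mulrAC mulrA.
Qed.

End atoms.

(** * Moments *)

Section charge_integral_linear.
Context d (T : measurableType d) (R : realType).
Variable nu : {charge set T -> \bar R}.

Lemma charge_integralD (f g : T -> R) :
  (charge_total_variation nu).-integrable setT (EFin \o f) ->
  (charge_total_variation nu).-integrable setT (EFin \o g) ->
  charge_integral nu (fun x => f x + g x) = charge_integral nu f + charge_integral nu g.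
Proof.
move=> fi gi.
have pos_le A : measurable A -> (jordan_pos (hahn nu) A <= charge_total_variation nu A)%E.
  by move=> mA; rewrite leeDl.
have neg_le A : measurable A -> (jordan_neg (hahn nu) A <= charge_total_variation nu A)%E.
  by move=> mA; rewrite leeDr.
rewrite /charge_integral !RintegralD //; try exact: integrable_le_measure fi;
  try exact: integrable_le_measure gi.
by rewrite opprD addrACA.
Qed.

End charge_integral_linear.

Section moments.
Variables (R : realType) (d : nat) (nu : {charge set (d.-tuple R) -> \bar R}).
Hypothesis nu_int : forall f : d.-tuple R -> R,
  measurable_fun setT f -> poly_growth f ->
  (charge_total_variation nu).-integrable setT (EFin \o f).

Lemma poly_growth_ceval (f : cpoly R d) : poly_growth (fun x => complex.Re (ceval f x)).
Proof.
have [C [N [C0 fC]]] := Re_ceval_bound f; exists C, N; split => // r x r0 Sx.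
by apply: fC => // i; rewrite -Sx ler_tnth_enorm.
Qed.

Lemma cevalZ c (f : cpoly R d) x : ceval (c *: f) x = c * ceval f x.
Proof. exact: mpoly.mevalZ. Qed.

Lemma Im_ceval (f : cpoly R d) x :
  complex.Im (ceval f x) = complex.Re (ceval (Complex 0 (-1) *: f) x).
Proof. by rewrite cevalZ Im_Re. Qed.

Lemma integrable_Re_ceval (f : cpoly R d) :
  (charge_total_variation nu).-integrable setT (fun x => (complex.Re (ceval f x))%:E).
Proof.
by apply: nu_int; [exact: measurable_Re_ceval|exact: poly_growth_ceval].
Qed.

Lemma integrable_Im_ceval (f : cpoly R d) :
  (charge_total_variation nu).-integrable setT (fun x => (complex.Im (ceval f x))%:E).
Proof.
by under eq_fun do rewrite Im_ceval; exact: integrable_Re_ceval.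
Qed.

Lemma charge_cintegral_cevalD (f g : cpoly R d) :
  charge_cintegral nu (ceval (f + g)) =
  charge_cintegral nu (ceval f) + charge_cintegral nu (ceval g).
Proof.
apply/eqP; rewrite eq_complex /=; apply/andP; split; apply/eqP.
  rewrite -charge_integralD; try exact: integrable_Re_ceval.
  by congr charge_integral; apply/funext => x; rewrite cevalD raddfD.
rewrite -charge_integralD; try exact: integrable_Im_ceval.
by congr charge_integral; apply/funext => x; rewrite cevalD raddfD.
Qed.

Lemma charge_cintegral_ceval_sum (I : Type) (s : seq I) (F : I -> cpoly R d) :
  charge_cintegral nu (ceval (\sum_(i <- s) F i)) =
  \sum_(i <- s) charge_cintegral nu (ceval (F i)).
Proof.
apply: (big_morph (fun f => charge_cintegral nu (ceval f)) charge_cintegral_cevalD).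
by apply: (addrI (charge_cintegral nu (ceval 0))); rewrite -charge_cintegral_cevalD !addr0.
Qed.

End moments.

(** * Pseudo-positivity and the representation of the functional *)

Lemma compact_support_bounded (R : realType) (h : R -> R) (M : R) :
  {within `[0, +oo[, continuous h} -> (forall r, 0 <= r -> 0 <= h r) ->
  (forall r, M < r -> h r = 0) ->
  exists C, 0 <= C /\ forall r, 0 <= r -> h r <= C.
Proof.
move=> ch h0 hM.
(* M may be negative; the maximum keeps [0, b] nonempty for the extreme value theorem. *)
pose b := Num.max M 0.
have b0 : 0 <= b by rewrite le_max lexx orbT.
have cb : {within `[0, b], continuous h}.
  apply: continuous_subspaceW ch => x /=; rewrite !in_itv /= => /andP [-> _] //.
have [c cb' hc] := EVT_max b0 cb.
have c0 : 0 <= c by move: cb'; rewrite in_itv /= => /andP [].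
exists (h c); split => [|r r0]; first exact: h0.
have [rb|br] := lerP r b; first by apply: hc; rewrite in_itv /= r0.
by rewrite hM ?h0 // (le_lt_trans _ br) // le_max lexx.
Qed.

Lemma measurable_radial_fun (R : realType) d (h : R -> R) :
  {within `[0, +oo[, continuous h} ->
  measurable_fun setT (fun x : d.-tuple R => h (enorm x)).
Proof.
move=> ch.
have mh : measurable_fun (`[0, +oo[%classic : set R) h.
  exact: subspace_continuous_measurable_fun.
apply: (measurable_comp _ _ mh (@measurable_enorm R d)) => //.
by move=> _ [x _ <-]; rewrite /= in_itv /= andbT enorm_ge0.
Qed.

Theorem theorem10 (R : realType) (d n : nat) (a : nat -> nat)
    (Y : forall k, 'I_(a k) -> cpoly R d)
    (T : cpoly R d -> R[i])
    (sigma : forall k, 'I_(a k) -> {measure set R -> \bar R})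
    (d_gt0 : (0 < d)%N)
    (n_gt0 : (0 < n)%N)
    (Y_basis : orthonormal_harmonic_basis Y)
    (T_linear : linear_on (U Y (2 * n)) T)
    (T_ppd : pseudo_positive_definite Y n T)
    (sigma_gauss : forall k (l : 'I_(a k)),
        gauss_jacobi n (component Y T l) (sigma k l))
    (C_fin : forall N : nat, (C_ sigma N < +oo)%E) :
  exists mu : {charge set (d.-tuple R) -> \bar R},
    [/\ pseudo_positive Y mu,
        moment_measure mu
      & forall f : cpoly R d, U Y (2 * n - 1) f ->
          T f = charge_cintegral mu (ceval f)].
Proof.
(* The number of nodes depends on (k, l), so the choice runs over tagged indices and returns that
   number packed with the nodes and weights. *)
have /choice [z zP] : forall i : {k : nat & 'I_(a k)},
    exists z : {m : nat & (('I_m -> R) * ('I_m -> R))%type},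
    [/\ forall j, 0 <= (tagged z).1 j, forall j, 0 < (tagged z).2 j,
        forall A, measurable A -> sigma (tag i) (tagged i) A =
          (\sum_(j < tag z) ((tagged z).2 j)%:E * \d_((tagged z).1 j) A)%E &
        forall p : {poly R[i]}, (size p <= 2 * n)%N ->
          T (radial d p * Y (tag i) (tagged i)) =
          \sum_(j < tag z) ((tagged z).2 j)%:C%C * p.[((tagged z).1 j)%:C%C]].
  move=> [k l]; have [m [t [alpha P]]] := gauss_jacobi_nodes n_gt0
    (fun c p q => component_linear T_linear l c (p := p) (q := q))
    (T_ppd k l) (sigma_gauss k l).
  by exists (existT _ m (t, alpha)).
pose idx k (l : 'I_(a k)) : {k : nat & 'I_(a k)} := Tagged _ l.
pose m k (l : 'I_(a k)) := tag (z (idx k l)).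
pose t k (l : 'I_(a k)) : 'I_(m k l) -> R := (tagged (z (idx k l))).1.
pose alpha k (l : 'I_(a k)) : 'I_(m k l) -> R := (tagged (z (idx k l))).2.
have alpha_gt0 k (l : 'I_(a k)) i : 0 < alpha k l i by have [_ + _ _] := zP (idx k l); apply.
have t_ge0 k (l : 'I_(a k)) i : 0 <= t k l i by have [+ _ _ _] := zP (idx k l); apply.
have sigmaE k (l : 'I_(a k)) A : measurable A ->
    sigma k l A = (\sum_(i < m k l) (alpha k l i)%:E * \d_(t k l i) A)%E.
  by have [_ _ + _] := zP (idx k l); apply.
have TE k (l : 'I_(a k)) (p : {poly R[i]}) : (size p <= 2 * n)%N ->
    T (radial d p * Y k l) = \sum_(i < m k l) (alpha k l i)%:C%C * p.[(t k l i)%:C%C].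
  by have [_ _ _] := zP (idx k l); apply.
clearbody m t alpha.
have rn0 := radius_neq0 alpha_gt0 sigmaE C_fin.
have [nu nuE] := exists_harm_charge Y_basis (atoms_summable alpha_gt0 sigmaE C_fin).
have nu_int f mf gf := (nuE f mf gf).1.
(* The r^k of [exists_harm_charge] cancels the one in the weights, leaving the integral of h(sqrt t)
   against sigma_{k,l}. Pseudo-positivity takes h to be the test function, the representation takes
   h(r) = Re q(r^2). *)
have key (h : R -> R) k (l : 'I_(a k)) :
    measurable_fun setT (fun x : d.-tuple R => h (enorm x) * harm Y l x) ->
    poly_growth (fun x : d.-tuple R => h (enorm x) * harm Y l x) ->
    charge_integral nu (fun x => h (enorm x) * harm Y l x) =
    \sum_(i < m k l) alpha k l i * h (Num.sqrt (t k l i)).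
  move=> mf gf; rewrite ((nuE _ mf gf).2 k l h) // big_mkcond /=.
  rewrite (sum_atoms t alpha_gt0 (fun l' w r => if l' == l then w * h r * r ^+ k else 0)).
  rewrite (bigD1 l) //= [X in _ + X]big1 ?addr0; last first.
    by move=> l' /negbTE ll; rewrite big1 // => i _; rewrite ll.
  apply: eq_bigr => i _; rewrite eqxx.
  by rewrite mulrAC divfK ?rn0.
exists nu; split.
- move=> h ch h0 [M hM] k l.
  have [C [C0 hC]] := compact_support_bounded ch h0 hM.
  rewrite [X in charge_integral nu X](_ : _ = fun x => h (enorm x) * harm Y l x) //.
  rewrite key.
  + by apply: sumr_ge0 => i _; rewrite mulr_ge0 ?h0 ?sqrtr_ge0 // ltW.
  + by apply: measurable_funM; [exact: measurable_radial_fun|exact: measurable_harm].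
  + have [D [D0 hD]] := harm_bound Y l.
    (* On the sphere of radius r the modulus is at most C r^k D. *)
    exists (C * D), k; split => [|r x r0 Sx]; first exact: mulr_ge0.
    rewrite (harm_dilation Y_basis) enorm_dilation // (Sx : enorm x = 1) mulr1.
    rewrite !normrM (ger0_norm (h0 r r0)) (ger0_norm (exprn_ge0 k r0)) -mulrA.
    apply: ler_pM => //; [exact: h0|by rewrite mulr_ge0 // exprn_ge0|exact: hC|].
    rewrite mulrC; apply: ler_pM => //; [exact: exprn_ge0|exact: hD|by rewrite lerDr].
- move=> f; split; [exact: integrable_Re_ceval|exact: integrable_Im_ceval].
move=> f [K [p [sp ->]]].
have Ut k (l : 'I_(a k)) : U Y (2 * n) (radial d (p k l) * Y k l).
  by apply: U_term; rewrite (leq_trans (sp k l)) //; lia.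
have Uk k : U Y (2 * n) (\sum_(l < a k) radial d (p k l) * Y k l).
  exact: (linear_on_sum T_linear _ (Ut k)).1.
rewrite (linear_on_sum T_linear _ (fun k : 'I_K => Uk k)).2.
rewrite (charge_cintegral_ceval_sum nu_int); apply: eq_bigr => k _.
rewrite (linear_on_sum T_linear _ (Ut k)).2.
rewrite (charge_cintegral_ceval_sum nu_int); apply: eq_bigr => l _.
(* [sp] bounds the size by (2n - 1).+1, which equals 2n because n > 0: exactly the range of [TE]. *)
rewrite TE; last by apply: (leq_trans (sp k l)); lia.
have part (q : {poly R[i]}) :
    charge_integral nu (fun x => complex.Re (ceval (radial d q * Y k l) x)) =
    \sum_(i < m k l) alpha k l i * complex.Re q.[(t k l i)%:C%C].
  have E : (fun x : d.-tuple R => complex.Re (ceval (radial d q * Y k l) x)) =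
      (fun x => complex.Re q.[(enorm x ^+ 2)%:C%C] * harm Y l x).
    apply/funext => x; rewrite cevalM (ceval_harm Y_basis) Re_mul_real // ceval_radial //.
  rewrite E (key (fun r => complex.Re q.[(r ^+ 2)%:C%C])).
  - by apply: eq_bigr => i _; rewrite sqr_sqrtr.
  - by rewrite -E; exact: measurable_Re_ceval.
  - by rewrite -E; exact: poly_growth_ceval.
apply/eqP; rewrite eq_complex /= !raddf_sum /=; apply/andP; split; apply/eqP.
  rewrite part; apply: eq_bigr => i _.
  by case: (_.[_]) => u v /=; rewrite mul0r subr0.
(* The imaginary part is the real part for -i times the polynomial, so [part] covers it as well. *)
transitivity (charge_integral nu (fun x =>
    complex.Re (ceval (radial d (Complex 0 (-1) *: p k l) * Y k l) x))).
  rewrite part; apply: eq_bigr => i _; rewrite -Im_horner.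
  by case: (_.[_]) => u v /=; rewrite mul0r addr0.
congr charge_integral; apply/funext => x.
rewrite Im_ceval -[Complex 0 (-1) *: p k l]addr0 radialZD radial0 addr0.
by rewrite -scalerAl.
Qed.
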